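(* Suppose that $\chi$ is a non-principal Dirichlet character modulo a prime $p\geq 10^7$, that $u$ is a prime with $u\geq e^2\log p$, and that $H$ is a positive integer such that $\chi(n)=1$ for all integers $n\in[1,H]$ with $\gcd(n,u)=1$. If $$H\leq (2e^2\log p-2)^{1/2}p^{1/2},$$ then $$H\leq K\,g(p)\,p^{1/4}\log p,$$ where $K=\pi e/\sqrt{2}$ and $$g(p)=\sqrt{\frac{1+\frac{4}{3\log p}}{\left(1-\frac{1}{e^2\log p}\right) f\!\left(\frac{Kp^{1/4}}{2e^2},\,89\right)}}.$$ Moreover, the function $g(p)$ is positive and decreasing for $p\geq 10^7$, and $g(p)\to 1$ as $p\to\infty$.
   Context: For real $X>1$ and prime $u$, $$f(X,u)=1-\frac{\pi^2}{3}\left(\frac{1}{2X^2}+\frac{1}{2X}+\frac{1}{1-u^{-1}}\cdot\frac{1+\log X}{X}\right),$$ with $\log$ the natural logarithm. *)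

(* Defs.v *)
From mathcomp Require Import all_boot all_order all_algebra.
From mathcomp Require Import complex.
From mathcomp Require Import all_classical all_reals all_analysis.

Set Implicit Arguments.
Unset Strict Implicit.
Unset Printing Implicit Defensive.

Import Order.TTheory GRing.Theory Num.Theory.
Import numFieldNormedType.Exports.

Local Open Scope ring_scope.

Definition dirichlet_character (R : realType) (q : nat) (chi : int -> R[i]) :
    Prop :=
  [/\ forall n : int, chi (n + q%:Z) = chi n,
      forall m n : int, chi (m * n) = chi m * chi n
    & forall n : int, chi n != 0 <-> coprimez n q%:Z].

Definition principal_character (R : realType) (q : nat) (n : int) : R[i] :=
  if coprimez n q%:Z then 1 else 0.

Definition f (R : realType) (X : R) (u : nat) : R :=
  1 - pi ^+ 2 / 3 *
    (1 / (2 * X ^+ 2) + 1 / (2 * X)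
     + 1 / (1 - u%:R^-1) * ((1 + ln X) / X)).

Definition e (R : realType) : R := expR 1.
Arguments e {R}.

Definition K (R : realType) : R := pi * e / Num.sqrt 2.
Arguments K {R}.

(* The argument is real, so that monotonicity and the limit are those of a
   function on the half-line and not only of its values at primes. *)
Definition g (R : realType) (x : R) : R :=
  Num.sqrt ((1 + 4 / (3 * ln x)) /
    ((1 - 1 / (e ^+ 2 * ln x)) * f (K * x `^ (1 / 4) / (2 * e ^+ 2)) 89)).

(* Main.v *)
Require Import Defs.
From mathcomp Require Import all_boot all_order all_algebra all_fingroup.
From mathcomp Require Import cyclic finfield complex.
From mathcomp Require Import all_classical all_reals all_analysis.
From mathcomp Require Import ring lra zify.

Set Implicit Arguments.
Unset Strict Implicit.
Unset Printing Implicit Defensive.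

Import Order.TTheory GRing.Theory Num.Theory.
Import numFieldNormedType.Exports.

Local Open Scope ring_scope.

(** Some power of [chi] gives a prime [l | p - 1] such that every [n] with
    [chi n = 1] is an [l]-th power residue.  Put [L = ln p], [r ~ L / 4] and
    [h = 21 r <= e^2 L <= u].  If [v + m q] lies in [1, H] for all [m < h], with
    [v] and [q] coprime, then at most one of the [v + m q] is divisible by [u],
    so the residue [x = v / q] mod [p] has [x + m] in a single coset of the
    [l]-th powers for all but at most one [m < h].  The same holds for
    [- x - (h - 1)], and this produces at least about [H^2 / (2 h)] such [x].

    From above, these [x] are counted by a moment of order [2 r], in which
    Weil's bound is replaced by a one-sided bound that Stepanov's method gives
    directly over 'F_p: the equation [a(x)^s = b(x)^s <> 0], [s = (p - 1) / l],
    with [a], [b] split of degree [r], has at most [p / l + (2 r + 1) sqrt p]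
    solutions as soon as some root has multiplicities in [a] and [b] that differ
    mod [l].  A one-sided bound suffices because the moment is organised as a
    sum over [x] of variances of counts of tuples over the cosets, all of them
    nonnegative, and is only needed from above.  Comparing the two estimates gives
    [H <= (28 / 5) p^(1/4) L], and [28 / 5 <= K <= K g(p)]. *)

(** * Stepanov's method *)

(** Produces the coefficients of the auxiliary polynomial, once there are more monomials [I] than
    linear conditions [J]. *)
Lemma exists_nontrivial_solution (F : fieldType) (I J : finType)
    (A : I -> J -> F) : (#|J| < #|I|)%N ->
  exists2 c : I -> F, exists i, c i != 0 & forall j, \sum_i c i * A i j = 0.
Proof.
move=> ltJI; pose M := \matrix_(i < #|I|, j < #|J|) A (enum_val i) (enum_val j).
have : kermx M != 0.
  by rewrite -mxrank_eq0 mxrank_ker subn_eq0 -ltnNge (leq_ltn_trans (rank_leq_col M)).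
case/rowV0Pn => v /sub_kermxP vM /rV0Pn[i0 vi0].
exists (fun i => v 0 (enum_rank i)); first by exists (enum_val i0); rewrite enum_valK.
move=> j; have /matrixP/(_ 0 (enum_rank j)) := vM.
rewrite !mxE => vMj; rewrite -[RHS]vMj (reindex (@enum_val I predT)) /=; last first.
  exact: onW_bij (enum_val_bij _).
by apply: eq_bigr => i _; rewrite enum_valK mxE enum_rankK.
Qed.

(** Among the terms with nonzero coefficient, the one of least multiplicity at [al] cannot be
    cancelled: all the others are divisible by a higher power of [X - al]. *)
Lemma sum_distinct_mup_neq0 (F : fieldType) (I : finType) (al : F) (c : I -> F)
    (T : I -> {poly F}) :
  (forall i, T i != 0) -> injective (fun i => mup al (T i)) ->
  (exists i, c i != 0) -> \sum_i c i *: T i != 0.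
Proof.
move=> T0 Tinj [i1 ci1].
case: (@arg_minnP _ i1 (fun i => c i != 0) (fun i => mup al (T i)) ci1) => i0 ci0 mini0.
apply/eqP; rewrite (bigD1 i0) //= => /eqP; rewrite addr_eq0 => /eqP eT.
have : ('X - al%:P) ^+ (mup al (T i0)).+1 %| c i0 *: T i0.
  rewrite eT dvdpNr; apply: (big_ind (fun Q => _ %| Q)) => [|x y|i ni]; [exact: dvdp0|exact: dvdp_add|].
  have [->|ci] := eqVneq (c i) 0; first by rewrite scale0r dvdp0.
  rewrite dvdpZr // -mup_geq // ltn_neqAle mini0 // andbT.
  by apply: contra ni => /eqP /Tinj ->.
by rewrite dvdpZr // -mup_geq // ltnn.
Qed.

Lemma iter_derivation_XsubC (F : fieldType) (B Q : {poly F}) (x : F) (m k : nat) :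
  (k <= m)%N -> exists2 Qk,
    iter k (fun P => B * P^`()) (('X - x%:P) ^+ m * Q) = ('X - x%:P) ^+ (m - k) * Qk &
    Qk.[x] = (m ^_ k)%:R * B.[x] ^+ k * Q.[x].
Proof.
elim: k => [|k IHk] lekm; first by exists Q; rewrite ?subn0 // ffactn0 mul1r mul1r.
have [Qk eQk Qkx] := IHk (ltnW lekm).
exists (B * ((m - k)%:R *: Qk + ('X - x%:P) * Qk^`())).
  rewrite iterS eQk -(subnSK lekm) derivM deriv_exp derivXsubC mul1r /=.
  rewrite -mulr_natr exprS scaler_nat -mulr_natr.
  set X := ('X - _) ^+ _; ring.
rewrite !hornerE Qkx subrr mul0r addr0 ffactnSr natrM exprS; ring.
Qed.

Lemma natr_Fp_eq0 (p n : nat) : prime p -> ((n%:R : 'F_p) == 0) = (p %| n)%N.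
Proof. by move=> p_pr; rewrite (dvdn_pcharf (pchar_Fp p_pr)). Qed.

Lemma natr_Fp_inj (p a b : nat) : ((a%:R : 'F_p) = b%:R) -> prime p ->
  (a < p)%N -> (b < p)%N -> a = b.
Proof.
move=> eab p_pr; wlog: a b eab / (a <= b)%N => [hw ap bp|ab ap bp].
  by case/orP: (leq_total a b) => [/(hw _ _ eab)|/(hw _ _ (esym eab))]; [apply|move=> ->].
apply/eqP; rewrite eqn_leq ab /= -subn_eq0; apply/negPn/negP => ba.
have : (p %| b - a)%N by rewrite -natr_Fp_eq0 // natrB // eab subrr.
by move/dvdn_leq; rewrite lt0n => /(_ ba); lia.
Qed.

(** If [P = (X - x)^m Q] with [m < M], the [m]-th iterate at [x] is [m! B(x)^m Q(x)]. As [m < p],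
    the factorial is invertible, so [Q] vanishes at [x] and the multiplicity goes up by one. *)
Lemma dvdp_XsubCX_iter (p : nat) (B P : {poly 'F_p}) (x : 'F_p) (M : nat) :
  prime p -> (M <= p)%N -> B.[x] != 0 ->
  (forall k, (k < M)%N -> (iter k (fun P => B * P^`()) P).[x] = 0) ->
  ('X - x%:P) ^+ M %| P.
Proof.
move=> p_pr; elim: M => [|M IHM] leMp Bx Pk; first by rewrite expr0 dvd1p.
have /dvdpP[Q] : ('X - x%:P) ^+ M %| P.
  by apply: IHM => //; [exact: ltnW|move=> k ltkM; apply: Pk; exact: ltnW].
rewrite mulrC => eP.
have [Qk eQk Qkx] := iter_derivation_XsubC B Q x (leqnn M).
have := Pk M (ltnSn M); rewrite eP eQk subnn expr0 mul1r Qkx ffactnn => /eqP.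
rewrite !mulf_eq0 expf_eq0 (negPf Bx) andbF natr_Fp_eq0 // orbF.
have -> : (p %| M`!)%N = false.
  apply/negbTE; elim: M {IHM Pk eP Qk eQk Qkx} leMp => [|M IHM] leMp.
    by rewrite dvdn1 neq_ltn prime_gt1 ?orbT.
  by rewrite factS Euclid_dvdM // negb_or IHM ?(ltnW leMp) // gtnNdvd.
by rewrite /= => Qx; rewrite exprSr dvdp_mul2l ?expf_neq0 ?polyXsubC_eq0 // dvdp_XsubCl.
Qed.

Lemma card_mul_multiplicity_lt_size (F : finFieldType) (P : {poly F}) (S : {set F}) (M : nat) :
  P != 0 -> (forall x, x \in S -> ('X - x%:P) ^+ M %| P) -> (M * #|S| < size P)%N.
Proof.
move=> P0 SP.
have dvd (s : seq F) : uniq s -> {subset s <= S} ->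
    \prod_(x <- s) ('X - x%:P) ^+ M %| P.
  elim: s => [|x s IHs] /=; first by rewrite big_nil dvd1p.
  case/andP=> xs us sS; rewrite big_cons Gauss_dvdp ?SP ?sS ?mem_head // ?IHs //.
    by move=> y ys; rewrite sS // inE ys orbT.
  rewrite big_seq; apply: (big_rec (fun Q => coprimep _ Q)) => [|y Q ys cQ]; first exact: coprimep1.
  rewrite coprimepMr cQ andbT coprimep_expl // coprimep_expr // coprimep_XsubC.
  by rewrite root_XsubC; apply: contraNneq xs => <-.
have := dvd (enum S) (enum_uniq _) (fun x => _); move=> /(_ _)/(dvdp_leq P0).
have -> : size (\prod_(x <- enum S) ('X - x%:P) ^+ M) = (M * #|S|).+1.
  rewrite prodrXl; set Q := \prod_(_ <- _) _.
  have := size_exp Q M; rewrite /Q size_prod_XsubC -cardE /= mulnC => <-.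
  by rewrite prednK // size_poly_gt0 expf_neq0 // monic_neq0 // monic_prod_XsubC.
by apply => x; rewrite mem_enum.
Qed.

Lemma mupX (F : fieldType) (x : F) (q : {poly F}) (n : nat) :
  q != 0 -> mup x (q ^+ n) = (n * mup x q)%N.
Proof.
move=> q0; elim: n => [|n IHn]; first by rewrite expr0 mupNroot // root1.
by rewrite exprS mupM ?expf_neq0 // IHn mulSn.
Qed.

Lemma mup_prod_XsubC_ord (F : fieldType) (r : nat) (al : 'I_r -> F) (v : F) :
  mup v (\prod_i ('X - (al i)%:P)) = #|[pred i | al i == v]|.
Proof.
rewrite -(big_map al predT (fun y => 'X - y%:P)) mu_prod_XsubC count_map.
by rewrite cardE -size_filter /enum_mem; congr size; apply: eq_filter => i.
Qed.

(* The [d + p j + s (i na + (l - 1 - i) nb)] are the multiplicities at a root [v]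
   of the monomials of the auxiliary polynomial below. Since [s = (p - 1) / l],
   distinct [i] put them in disjoint intervals mod [p], which is what makes the
   auxiliary polynomial nonzero. *)
Lemma stepanov_exponent_inj (p l s r D na nb i j d i' j' d' : nat) :
  prime l -> p = (l * s).+1 -> (D + r <= s)%N ->
  (na <= r)%N -> (nb <= r)%N -> ~~ (na == nb %[mod l])%N ->
  (i < l)%N -> (i' < l)%N -> (d < D)%N -> (d' < D)%N ->
  (d + p * j + (s * i * na + s * (l.-1 - i) * nb) =
   d' + p * j' + (s * i' * na + s * (l.-1 - i') * nb))%N ->
  [/\ i = i', j = j' & d = d'].
Proof.
move=> l_pr ep Ds nar nbr na_nb il i'l dD d'D E.
pose w : int := (i%:Z - i'%:Z) * (na%:Z - nb%:Z).
have l_gt1 := prime_gt1 l_pr.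
have wr : `|w| <= ((l.-1) * r)%:Z.
  rewrite normrM PoszM ler_pM //; lia.
have E1 : (d%:Z - d'%:Z) + p%:Z * (j%:Z - j'%:Z) + s%:Z * w = 0.
  have [t et] : exists t, l.-1 = (t + i)%N by exists (l.-1 - i)%N; lia.
  have [t' et'] : exists t, l.-1 = (t + i')%N by exists (l.-1 - i')%N; lia.
  have eti : i%:Z = l.-1%:Z - t%:Z by lia.
  have eti' : i'%:Z = l.-1%:Z - t'%:Z by lia.
  have := congr1 Posz E; rewrite {1}et et' !addnK !PoszD !PoszM /w eti eti' => {}E; lra.
(* Multiplying by [l] and using [l s = p - 1] isolates a multiple of [p]. By [D + r <= s] the
   right-hand side is less than [p] in absolute value, so [l (j - j') + w = 0] and [l] divides
   [w]. *)
have E2 : p%:Z * (l%:Z * (j%:Z - j'%:Z) + w) = w - l%:Z * (d%:Z - d'%:Z).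
  have : l%:Z * ((d%:Z - d'%:Z) + p%:Z * (j%:Z - j'%:Z) + s%:Z * w) = 0 by rewrite E1 mulr0.
  have -> : p%:Z = l%:Z * s%:Z + 1 by rewrite ep; lia.
  move=> E3; lra.
have dd : `|l%:Z * (d%:Z - d'%:Z)| <= (l * D.-1)%:Z.
  by rewrite normrM PoszM ler_pM //; lia.
have Z0 : l%:Z * (j%:Z - j'%:Z) + w = 0.
  set z := _ + w in E2 *.
  have [//|z0] := eqVneq z 0.
  have : p%:Z <= `|p%:Z * z| by rewrite normrM ler_peMr //; lia.
  have -> : p%:Z * z = w - l%:Z * (d%:Z - d'%:Z) by [].
  move=> le1; have := le_trans le1 (ler_normB _ _).
  have : (l.-1 * r + l * D.-1 < p)%N.
    rewrite ep ltnS; apply: (@leq_trans (l * (D + r))); last by rewrite leq_mul2l Ds orbT.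
    rewrite mulnDr addnC leq_add // leq_mul //; lia.
  lia.
have : (l%:Z %| w)%Z by apply/dvdzP; exists (j'%:Z - j%:Z); lra.
rewrite dvdzE /w abszM Euclid_dvdM // => /orP[|] ldvd; last first.
  case/negP: na_nb; case/orP: (leq_total na nb) => le.
    by rewrite eq_sym eqn_mod_dvd // -distnEr.
  by rewrite eqn_mod_dvd // -distnEl.
have ii' : i = i'.
  apply/eqP; rewrite -distn_eq0 -leqn0 leqNgt; apply/negP => /dvdn_leq/(_ ldvd).
  by move: il i'l; clear; lia.
have jj' : j = j'.
  move: Z0; rewrite /w ii' subrr mul0r addr0 => /eqP.
  by rewrite mulf_eq0 subr_eq0 !eqz_nat; case: eqP => [l0|_ /eqP//]; rewrite l0 in l_gt1.
split=> //; move: E1; rewrite /w ii' jj' !subrr mul0r !mulr0 !addr0 => /eqP.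
by rewrite subr_eq0 eqz_nat => /eqP.
Qed.

(** * The auxiliary polynomial *)

Section Stepanov.
Variables (p l s r M J D : nat) (al be : 'I_r -> 'F_p) (v : 'F_p).
Hypotheses (p_pr : prime p) (l_pr : prime l) (ep : p = (l * s).+1).
Hypotheses (r_gt0 : (0 < r)%N) (Ds : (D + r <= s)%N) (leMp : (M <= p)%N).
(** The unknowns are the [l J D] coefficients. The [k]-th of the [M] derivatives costs
    [D + J + k (2 r - 1)] conditions, and these sum to at most the left-hand side. *)
Hypothesis card_lt : (M * (D + J) + r * M ^ 2 < l * J * D)%N.
Hypothesis nondeg : ~~ (#|[pred i | al i == v]| == #|[pred i | be i == v]| %[mod l])%N.

Let a : {poly 'F_p} := \prod_i ('X - (al i)%:P).
Let b : {poly 'F_p} := \prod_i ('X - (be i)%:P).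
Let I : finType := ('I_l * 'I_J * 'I_D)%type.
Let ea (i : I) := (s * i.1.1)%N.
Let eb (i : I) := (s * (l.-1 - i.1.1))%N.
Let T (i : I) : {poly 'F_p} := ('X - v%:P) ^+ (i.2 + p * i.1.2) * (a ^+ ea i * b ^+ eb i).

Let a_neq0 : a != 0. Proof. by rewrite monic_neq0 // monic_prod_XsubC. Qed.
Let b_neq0 : b != 0. Proof. by rewrite monic_neq0 // monic_prod_XsubC. Qed.
Let size_a : size a = r.+1.
Proof. by rewrite /a size_prod_XsubC /index_enum -enumT size_enum_ord. Qed.
Let size_b : size b = r.+1.
Proof. by rewrite /b size_prod_XsubC /index_enum -enumT size_enum_ord. Qed.

Let T_neq0 i : T i != 0.
Proof. by rewrite !mulf_neq0 ?expf_neq0 ?polyXsubC_eq0. Qed.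

Let mup_T_inj : injective (fun i => mup v (T i)).
Proof.
move=> [[i j] d] [[i' j'] d'] /=.
rewrite !mupM ?mulf_neq0 ?expf_neq0 ?polyXsubC_eq0 //.
have mX : mup v ('X - v%:P) = 1%N by rewrite -[_ - _]expr1 mup_XsubCX eqxx.
rewrite !mupX ?polyXsubC_eq0 // mX !muln1.
rewrite !mup_prod_XsubC_ord.
set na := #|_|; set nb := #|_| => E.
have nar : (na <= r)%N by rewrite -[X in (_ <= X)%N]card_ord max_card.
have nbr : (nb <= r)%N by rewrite -[X in (_ <= X)%N]card_ord max_card.
have [/val_inj ei /val_inj ej /val_inj ed] := stepanov_exponent_inj l_pr ep Ds nar nbr nondeg
  (ltn_ord i) (ltn_ord i') (ltn_ord d) (ltn_ord d') E.
by move: ei ej ed => /= -> -> ->.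
Qed.

(* [Dl i] is the derivation [a b d/dx] transported through the factor
   [a ^+ ea i * b ^+ eb i], and [x ^ p] is a constant for it. At a point where
   [a ^+ s = b ^+ s] those factors all take the same value and [x ^ p = x], so
   vanishing of the k-th derivative there only costs the coefficients of one
   polynomial of size at most [D + J + k (2 r - 1)]. *)
Let Dl (i : I) (A : {poly 'F_p}) :=
  a * b * A^`() + (ea i)%:R * A * a^`() * b + (eb i)%:R * A * a * b^`().
Let B := a * b.
Let A0 (i : I) k := iter k (Dl i) (('X - v%:P) ^+ i.2).

Let derivX_mul (F : fieldType) (q : {poly F}) n : q * (q ^+ n)^`() = n%:R * q^`() * q ^+ n.
Proof.
rewrite deriv_exp -mulr_natr; case: n => [|n]; first by rewrite mulr0 mulr0 mul0r mul0r.
rewrite /= exprS; ring.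
Qed.

Let deriv_pow_p (q : {poly 'F_p}) n : (q ^+ (p * n))^`() = 0.
Proof. by rewrite deriv_exp -mulr_natr natrM -polyC_natr pchar_Fp_0 // mul0r mulr0. Qed.

Let iterT (c : I -> 'F_p) k :
  iter k (fun P => B * P^`()) (\sum_i c i *: T i) =
  \sum_i c i *: (A0 i k * ((a ^+ ea i * b ^+ eb i) * ('X - v%:P) ^+ (p * i.1.2))).
Proof.
elim: k => [|k IHk].
  by apply: eq_bigr => i _; rewrite /T exprD /A0 /=; congr (_ *: _); ring.
rewrite iterS {}IHk raddf_sum mulr_sumr; apply: eq_bigr => i _.
rewrite [X in B * X]derivZ -scalerAr; congr (_ *: _); rewrite /A0 iterS -/(A0 i k) /Dl.
rewrite !derivM deriv_pow_p mulr0 addr0.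
have := derivX_mul a (ea i); have := derivX_mul b (eb i).
move: ((a ^+ _)^`()) ((b ^+ _)^`()) => da db Eb Ea.
rewrite /B; move: (_ ^+ (p * _)) (A0 i k) => X A.
transitivity (a * b * A^`() * a ^+ ea i * b ^+ eb i * X
   + A * b * (a * da) * b ^+ eb i * X + A * a * (b * db) * a ^+ ea i * X); first by ring.
by rewrite Ea Eb; ring.
Qed.

Let size_A0 i k : (size (A0 i k) <= D + k * (2 * r).-1)%N.
Proof.
elim: k => [|k IHk]; first by rewrite /A0 /= size_exp_XsubC addn0.
rewrite /A0 iterS -/(A0 i k) /Dl; move: (A0 i k) IHk => A le_A.
have sM (P Q : {poly 'F_p}) m n : (size P <= m)%N -> (size Q <= n)%N -> (size (P * Q)%R <= (m + n).-1)%N.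
  by move=> Pm Qn; apply: leq_trans (size_polyMleq _ _) _; rewrite -!subn1 leq_sub2r // leq_add.
have sn (n : nat) : (size (n%:R : {poly 'F_p}) <= 1)%N by rewrite -polyC_natr size_polyC leq_b1.
have sa' : (size a^`() <= r)%N by rewrite -ltnS -size_a lt_size_deriv.
have sb' : (size b^`() <= r)%N by rewrite -ltnS -size_b lt_size_deriv.
have sA' : (size A^`() <= (D + k * (2 * r).-1).-1)%N.
  have [->|A1] := eqVneq A 0; first by rewrite deriv0 size_poly0.
  by rewrite -ltnS prednK ?(leq_trans (lt_size_deriv A1)) // addn_gt0 (leq_ltn_trans _ (ltn_ord i.2)).
have D0 : (0 < D)%N by rewrite (leq_ltn_trans _ (ltn_ord i.2)).
have sae : (size a <= r.+1)%N by rewrite size_a.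
have sbe : (size b <= r.+1)%N by rewrite size_b.
have t1 := sM _ _ _ _ (sM _ _ _ _ sae sbe) sA'.
have t2 := sM _ _ _ _ (sM _ _ _ _ (sM _ _ _ _ (sn (ea i)) le_A) sa') sbe.
have t3 := sM _ _ _ _ (sM _ _ _ _ (sM _ _ _ _ (sn (eb i)) le_A) sae) sb'.
apply: leq_trans (size_polyD _ _) _; rewrite geq_max; apply/andP; split; last first.
  by apply: leq_trans t3 _; rewrite (mulSn k); move: (k * _)%N r_gt0 D0; clear; lia.
apply: leq_trans (size_polyD _ _) _; rewrite geq_max; apply/andP; split.
  by apply: leq_trans t1 _; rewrite (mulSn k); move: (k * _)%N r_gt0 D0; clear; lia.
by apply: leq_trans t2 _; rewrite (mulSn k); move: (k * _)%N r_gt0 D0; clear; lia.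
Qed.

Let card_conditions : (#|{: {k : 'I_M & 'I_(D + J + k * (2 * r).-1)}}| < #|I|)%N.
Proof.
rewrite card_tagged sumnE big_map big_enum /= /I !card_prod !card_ord.
apply: leq_ltn_trans card_lt.
under eq_bigr do rewrite card_ord.
rewrite -(big_mkord xpredT (fun k => D + J + k * (2 * r).-1)%N).
elim: M => [|m IHm]; first by rewrite big_geq.
rewrite big_nat_recr //=; apply: (leq_trans (leq_add IHm (leqnn _))).
by move: r_gt0; clear; nia.
Qed.

Let size_T i : (size (T i) <= (p * (J.-1 + r)).+1)%N.
Proof.
have sX (q : {poly 'F_p}) n m : size q = m.+1 -> (size (q ^+ n)%R <= m * n + 1)%N.
  by move=> sq; rewrite addn1 (leq_trans (size_poly_exp_leq _ _)) // sq.
apply: leq_trans (size_polyMleq _ _) _; rewrite size_exp_XsubC addSn /=.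
have ab : (size (a ^+ ea i * b ^+ eb i)%R <= r * ea i + r * eb i + 1)%N.
  apply: leq_trans (size_polyMleq _ _) _.
  have := sX _ (ea i) _ size_a; have := sX _ (eb i) _ size_b; lia.
apply: leq_trans (leq_add (leqnn _) ab) _.
rewrite -mulnDr /ea /eb -mulnDr subnKC; last by rewrite -ltnS prednK ?prime_gt0.
have := ltn_ord i.2; have := ltn_ord i.1.2.
move: (val i.2) (val i.1.2) => d j jJ dD.
have lej : (j <= J.-1)%N by rewrite -ltnS prednK // (leq_ltn_trans _ jJ).
rewrite mulnDr addn1 addnS ltnS -addnA addnCA leq_add ?leq_mul2l ?lej ?orbT //.
have := prime_gt0 l_pr; move: ep Ds r_gt0 dD; clear.
case: l => // m ep Ds r0 dD _ /=.
(* Since [d < s r], the exponent [d] fits in the missing [l]-th copy of [s r]: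
   [d + (l - 1) s r <= l s r <= p r]. *)
have : (D <= s * r)%N by rewrite (leq_trans (leq_trans (leq_addr _ _) Ds)) // leq_pmulr.
by rewrite ep; nia.
Qed.

(** The auxiliary polynomial is nonzero, has degree at most [p (J - 1 + r)] and vanishes to order
    [M] at every point of the set. *)
Lemma stepanov_pow : (M * #|[set x : 'F_p |
    [&& a.[x] != 0, b.[x] != 0 & a.[x] ^+ s == b.[x] ^+ s]%R]| <= p * (J.-1 + r))%N.
Proof.
have [c c0 cR] := exists_nontrivial_solution
  (fun (i : I) (ke : {k : 'I_M & 'I_(D + J + k * (2 * r).-1)}) =>
     (A0 i (tag ke) * ('X - v%:P) ^+ i.1.2)`_(tagged ke)) card_conditions.
pose P := \sum_i c i *: T i.
have P0 : P != 0 by exact: sum_distinct_mup_neq0 T_neq0 mup_T_inj c0.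
have sP : (size P <= (p * (J.-1 + r)).+1)%N.
  by apply: (leq_trans (size_sum _ _ _)); apply/bigmax_leqP => i _;
    apply: leq_trans (size_T i); apply: size_scale_leq.
have R0 k : (k < M)%N -> \sum_i c i *: (A0 i k * ('X - v%:P) ^+ i.1.2) = 0.
  move=> kM; apply/polyP => e; rewrite coef0.
  have [le_e|lt_e] := leqP (D + J + k * (2 * r).-1) e; last first.
    rewrite -[RHS](cR (existT _ (Ordinal kM) (Ordinal lt_e))) coef_sum.
    by apply: eq_bigr => i _; rewrite coefZ.
  rewrite nth_default //; apply: leq_trans le_e.
  apply: (leq_trans (size_sum _ _ _)); apply/bigmax_leqP => i _.
  apply: leq_trans (size_scale_leq _ _) _; apply: leq_trans (size_polyMleq _ _) _.
  rewrite size_exp_XsubC addnS /= addnAC leq_add ?size_A0 //=.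
  exact: ltnW.
rewrite -ltnS; apply: leq_trans sP; apply: card_mul_multiplicity_lt_size => // x.
rewrite inE => /and3P[ax bx /eqP abx].
apply: (@dvdp_XsubCX_iter p B) => //; first by rewrite hornerM mulf_neq0.
move=> k kM; rewrite iterT horner_sum.
transitivity ((\sum_i c i *: (A0 i k * ('X - v%:P) ^+ i.1.2)).[x] * (b.[x] ^+ s) ^+ l.-1); last first.
  by rewrite R0 // horner0 mul0r.
rewrite horner_sum mulr_suml; apply: eq_bigr => i _.
rewrite !hornerZ !hornerM !horner_exp hornerXsubC [_ ^+ (p * _)]exprM.
have -> (y : 'F_p) : y ^+ p = y by rewrite -[RHS]expf_card card_Fp.
rewrite /ea /eb !exprM abx -exprD subnKC ?mulrA; first by rewrite -!mulrA [X in _ * (_ * X)]mulrC.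
by rewrite -ltnS prednK ?prime_gt0.
Qed.
End Stepanov.

(** Evaluates the degree bound for multiplicity [n], the integer part of [sqrt p], and [D = s - r];
    here [J] stands for the [J - 1] of [stepanov_pow]. With [E = l D - n], the hypotheses give
    [l N <= p (E + n + l r n) / E + l r p / n]. *)
Lemma stepanov_numerics (p l s r n J N : nat) :
  (1 < l)%N -> (l <= n)%N -> p = (l * s).+1 -> (n ^ 2 < p < n.+1 ^ 2)%N -> (0 < r)%N ->
  (2 * (r ^ 2 + 6 * r + 3) <= n)%N -> (J * (l * (s - r) - n) <= n * ((s - r) + r * n))%N ->
  (n * N <= p * (J + r))%N -> (l * N <= p + l * (2 * r + 1) * n)%N.
Proof.
move=> l1 ln ep /andP[np pn] r0 rn.
have rs : (r <= s)%N by nia.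
pose D := (s - r)%N; have es : s = (D + r)%N by rewrite subnK.
have lDn : (n < l * D)%N by nia.
rewrite -/D.
have [E eE] : exists E, (l * D = n + E)%N by exists (l * D - n)%N; lia.
rewrite eE addKn => JE nN.
have E0 : (0 < E)%N by lia.
have n0 : (0 < n)%N by lia.
rewrite -(leq_pmul2l n0) -(leq_pmul2l E0).
have ep2 : p = (n + E + l * r).+1 by rewrite ep es mulnDr eE.
have p1 : (p <= n ^ 2 + 2 * n)%N by lia.
(* What remains after [p / n <= n + 2], cleared of denominators. Since [p = E + 1 + l r + n], the
   margin is [E (l - 1) n], which has to absorb [(1 + l r + n) (l r + 1) n] and [2 E l r]. *)
have key : (p * (l * r * n + n) + E * l * (2 * r) <= E * (l * ((r + 1) * n)))%N.
  have lrn : (l * r <= n * r)%N by rewrite leq_mul2r ln orbT.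
  have k1 : (1 + l * r + n <= n * (r + 2))%N by move: lrn n0; clear; lia.
  have k2 : (l * r + 1 <= l * (r + 1))%N by move: l1; clear; lia.
  have [m em] : exists m, n = (m + r + 1)%N by exists (n - r - 1)%N; move: rn; clear; lia.
  have [t et] : exists t, n = (t + 4 * r)%N by exists (n - 4 * r)%N; move: rn; clear; lia.
  have k3 : (n * m <= E)%N.
    have : (n * n = n * m + n * r + n)%N by rewrite {2}em; ring.
    by move: np ep2 lrn; clear; lia.
  have k4 : (2 * n * (r + 2) * (r + 1) <= m * t)%N.
    have : (n * t = m * t + (r + 1) * t)%N by rewrite {1}em; ring.
    have : ((r + 1) * t <= (r + 1) * n)%N by rewrite leq_mul2l et leq_addr orbT.
    have : (n * (2 * (r + 2) * (r + 1) + (r + 1)) <= n * t)%N.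
      by rewrite leq_mul2l; apply/orP; right; move: rn et; clear; lia.
    by clear; lia.
  have k5 : (2 * ((1 + l * r + n) * (l * r + 1) * n) <= E * l * t)%N.
    apply: (@leq_trans (2 * (n * (r + 2) * (l * (r + 1)) * n))).
      by rewrite leq_pmul2l // leq_mul2r leq_mul ?orbT.
    have := leq_mul (leqnn (n * l)%N) k4; have := leq_mul k3 (leqnn (l * t)%N).
    by clear; lia.
  have k7 : (E * l * n <= 2 * (E * (l.-1 * n)))%N.
    have := leq_mul (leqnn (E * n)%N) (_ : l <= 2 * l.-1)%N.
    by move=> /(_ ltac:(lia)); clear; lia.
  have k8 : l = l.-1.+1 by move: l1; clear; lia.
  have k9 : (E * l * n = E * l * t + E * l * (4 * r))%N by rewrite -mulnDr et.
  move: (l.-1) k7 k8 => l' k7 k8.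
  have k10 : (E * (l * n) = E * n + E * (l' * n))%N by rewrite k8; ring.
  have -> : (E * (l * ((r + 1) * n)) = E * l * r * n + E * (l * n))%N by ring.
  have -> : (p * (l * r * n + n) = E * l * r * n + E * n + (1 + l * r + n) * (l * r + 1) * n)%N.
    by rewrite ep2; ring.
  by move: k5 k7 k9 k10; clear; move: ((1 + _ + n) * _ * n)%N => X; lia.
have h1 : (E * (n * (l * N)) <= l * (p * (J * E)) + l * E * p * r)%N.
  have := leq_mul (leqnn (E * l)%N) nN; lia.
have h2 : (l * (p * (J * E)) <= p * n * (n + E + l * r * n))%N.
  rewrite -eE; have := leq_mul (leqnn (l * p)%N) JE; lia.
have h3 : (l * E * p * r <= l * E * r * (n ^ 2 + 2 * n))%N by have := leq_mul (leqnn (l * E * r)%N) p1; lia.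
have h4 := leq_mul (leqnn n) key.
lia.
Qed.

Lemma card_agree (p l s r n : nat) (al be : 'I_r -> 'F_p) (v : 'F_p) :
  prime p -> prime l -> p = (l * s).+1 -> (0 < r)%N -> (n ^ 2 < p < n.+1 ^ 2)%N ->
  (2 * (r ^ 2 + 6 * r + 3) <= n)%N ->
  ~~ (#|[pred i | al i == v]| == #|[pred i | be i == v]| %[mod l])%N ->
  (l * #|[set x : 'F_p | [&& \prod_i (x - al i) != 0, \prod_i (x - be i) != 0 &
      (\prod_i (x - al i)) ^+ s == (\prod_i (x - be i)) ^+ s]%R]|
    <= p + l * (2 * r + 1) * n)%N.
Proof.
(* For [l <= sqrt p], Stepanov's method with multiplicity [n = floor (sqrt p)];
   for larger [l], the degree of [a ^+ s - b ^+ s] is already small enough. *)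
move=> p_pr l_pr ep r0 np rn nondeg.
pose a : {poly 'F_p} := \prod_i ('X - (al i)%:P).
pose b : {poly 'F_p} := \prod_i ('X - (be i)%:P).
have ha x : \prod_i (x - al i) = a.[x].
  by rewrite horner_prod; apply: eq_bigr => i _; rewrite hornerXsubC.
have hb x : \prod_i (x - be i) = b.[x].
  by rewrite horner_prod; apply: eq_bigr => i _; rewrite hornerXsubC.
rewrite (_ : [set x | _] = [set x : 'F_p | [&& a.[x] != 0, b.[x] != 0 & a.[x] ^+ s == b.[x] ^+ s]%R]); last first.
  by apply/setP => x; rewrite !inE ha hb.
set S := [set x | _].
have l1 := prime_gt1 l_pr.
have [ln|nl] := leqP l n.
  have ns : (n <= s)%N.
    rewrite -(@leq_pmul2l n); last by move: rn; clear; lia.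
    by apply: (@leq_trans (l * s)); [by case/andP: np; rewrite ep ltnS -mulnn|rewrite leq_mul2r ln orbT].
  pose D := (s - r)%N; have es : (D + r = s)%N by rewrite subnK //; move: rn ns; clear; lia.
  have [E E0 eE] : exists2 E, (0 < E)%N & (l * D = n + E)%N.
    have q1 : (l * s = l * D + l * r)%N by rewrite -es mulnDr.
    have q2 : (l * r <= n * r)%N by rewrite leq_mul2r ln orbT.
    have q3 : (n * (r + 2) <= n * n)%N by rewrite leq_mul2l; move: rn; clear; lia.
    case/andP: np; rewrite -mulnn => np _; exists (l * D - n)%N; move: np ep r0 rn q1 q2 q3; clear; lia.
  (* For [M = n] the count of unknowns against conditions reads [n (D + r n) < J E]; this is the
     least such [J]. *)
  pose J := (n * (D + r * n) %/ E).+1.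
  apply: (@stepanov_numerics _ _ s r n J.-1) => //; first by rewrite -/D eE addKn leq_trunc_div.
  apply: (@stepanov_pow p l s r n J D al be v) => //; first by rewrite es.
    by case/andP: np; clear; nia.
  have : (n * (D + r * n) < J * E)%N by rewrite ltn_ceil.
  by rewrite mulnAC eE expnS expn1; clear; lia.
have s0 : (0 < s)%N by case: (s) ep p_pr => // ->; rewrite muln0.
have sn : (s <= n)%N.
  rewrite leqNgt; apply/negP => ns; have := leq_mul nl ns.
  by case/andP: np => _; rewrite ep expnS expn1; lia.
have [a0 b0] : a != 0 /\ b != 0 by rewrite !monic_neq0 ?monic_prod_XsubC.
pose Q := a ^+ s - b ^+ s.
have Q0 : Q != 0.
  rewrite subr_eq0; apply: contraNneq nondeg => eab.
  have := congr1 (mup v) eab; rewrite !mupX // !mup_prod_XsubC_ord => /eqP.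
  by rewrite eqn_pmul2l // => /eqP ->.
have sQ : (size Q <= (r * s).+1)%N.
  rewrite (leq_trans (size_polyD _ _)) // size_polyN geq_max.
  rewrite !(leq_trans (size_poly_exp_leq _ _)) // size_prod_XsubC /index_enum -enumT size_enum_ord //.
have : (1 * #|S| < size Q)%N.
  apply: card_mul_multiplicity_lt_size => // x; rewrite inE => /and3P[_ _ /eqP E].
  by rewrite expr1 dvdp_XsubCl rootE !hornerE E subrr.
rewrite mul1n => /leq_trans/(_ sQ); rewrite ltnS => Srs.
apply: (@leq_trans (l * (r * n))); first by rewrite leq_mul2l (leq_trans Srs) ?orbT // leq_mul2l sn orbT.
rewrite -mulnA; apply: leq_trans (leq_addl _ _); rewrite leq_mul2l leq_mul2r.
by apply/orP; right; apply/orP; right; lia.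
Qed.

(** * The moment argument *)

(** With the value at [c0] fixed, the sum of squared deviations over [l] classes is least when the
    other [l - 1] classes are equal, and is then the left-hand side. If [A] has fewer than [l]
    elements, the missing classes count as zeros. *)
Lemma variance_lower_bound (R : realFieldType) (I : finType) (A : {set I}) (l : nat)
    (w : I -> R) (c0 : I) :
  (1 < l)%N -> (#|A| <= l)%N -> c0 \in A ->
  (w c0 - (\sum_(c in A) w c) / l%:R) ^+ 2 / (1 - l%:R^-1)
    <= \sum_(c in A) w c ^+ 2 - (\sum_(c in A) w c) ^+ 2 / l%:R.
Proof.
move=> l1 Al c0A; rewrite !(bigD1 c0 c0A) /=.
set T := \sum_(i in A | i != c0) w i; set T2 := \sum_(i in A | i != c0) _.
have [k el] : exists k, l = k.+2 by case: l l1 {Al} => [|[|k]] // _; exists k.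
have ek : (l%:R : R) = k.+1%:R + 1 by rewrite el -[k.+2]addn1 natrD.
have k0 : 0 < (k.+1%:R : R) by rewrite ltr0n.
pose y := T / k.+1%:R.
have : 0 <= \sum_(i in A | i != c0) (w i - y) ^+ 2 by apply: sumr_ge0 => i _; exact: sqr_ge0.
have -> : \sum_(i in A | i != c0) (w i - y) ^+ 2 =
    T2 - 2 * y * T + y ^+ 2 * #|A :\ c0|%:R.
  have -> : (#|A :\ c0|%:R : R) = \sum_(i in A | i != c0) 1.
    by rewrite -sum1_card natr_sum; apply: eq_bigl => i; rewrite !inE andbC.
  rewrite !mulr_sumr /T2 -sumrB.
  by rewrite -big_split /=; apply: eq_bigr => i _; ring.
have : (#|A :\ c0|%:R : R) <= k.+1%:R.
  by rewrite ler_nat -ltnS -el (leq_trans _ Al) // (cardsD1 c0 A) c0A.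
move: (_%:R) => a ak h.
have : y ^+ 2 * a <= y ^+ 2 * k.+1%:R by rewrite ler_wpM2l // sqr_ge0.
have eT : T = y * k.+1%:R by rewrite /y divfK // gt_eqF.
rewrite {}eT in h *; rewrite ek {}/y {ek} in h *; move: (T / _) h => y h.
move: (k.+1%:R) k0 ak h => K k0 ak h h2; move: (w c0) => W.
rewrite -subr_ge0.
have K1 : 0 < K + 1 by lra.
rewrite [leRHS](_ : _ = T2 - y ^+ 2 * K); first lra.
by field; rewrite addrK !gt_eqF.
Qed.

Lemma leq_card_bigcup (I T : finType) (P : pred I) (B : I -> {set T}) :
  (#|\bigcup_(i | P i) B i| <= \sum_(i | P i) #|B i|)%N.
Proof.
apply: (big_rec2 (fun (A : {set T}) n => #|A| <= n)%N); first by rewrite cards0.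
by move=> i n A _ An; rewrite (leq_trans (leq_card_setU _ _)) // leq_add.
Qed.

Lemma exists_superset_card (T : finType) (A : {set T}) (n : nat) :
  (#|A| <= n)%N -> (n <= #|T|)%N -> exists2 B : {set T}, A \subset B & #|B| = n.
Proof.
move=> An nT; pose s := take (n - #|A|) (enum (~: A)).
have us : uniq s by rewrite take_uniq // enum_uniq.
have sA : [disjoint A & [set x in s]].
  rewrite finset.disjoints_subset; apply/fintype.subsetP => x xA; rewrite !inE.
  by apply: contraL xA => /mem_take; rewrite mem_enum inE.
exists (A :|: [set x in s]); first exact: finset.subsetUl.
rewrite cardsU (eqP (_ : A :&: [set x in s] == finset.set0)) ?setI_eq0 //.
rewrite cards0 subn0 cardsE (card_uniqP us) size_take -cardE.
have := cardsC A; case: ltnP; lia.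
Qed.

(** The pairs to which [card_agree] does not apply at any [v]; for them only the trivial count [p]
    is available. *)
Definition degenerate (l r h : nat) (m m' : {ffun 'I_r -> 'I_h}) :=
  [forall v, #|[pred i | m i == v]| == #|[pred i | m' i == v]| %[mod l]].

(* In a degenerate pair every value is taken at least twice, hence the 2r entries
   take at most r values. *)
Lemma card_degenerate (l r h : nat) : (1 < l)%N -> (r <= h)%N ->
  (#|[set mm : {ffun 'I_r -> 'I_h} * {ffun 'I_r -> 'I_h} | degenerate l mm.1 mm.2]|
    <= 'C(h, r) * r ^ (2 * r))%N.
Proof.
move=> l1 rh.
pose im (m : {ffun 'I_r -> 'I_h}) := [set m i | i : 'I_r].
have small mm : degenerate l mm.1 mm.2 -> (#|im mm.1 :|: im mm.2| <= r)%N.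
  move=> /forallP deg; rewrite -(leq_pmul2l (ltn0Sn 1)).
  have sumr (m : {ffun 'I_r -> 'I_h}) : (\sum_v #|[pred i | m i == v]| = r)%N.
    rewrite -[RHS]card_ord -sum1_card (partition_big m xpredT) //=.
    by apply: eq_bigr => v _; rewrite -sum1_card; apply: eq_bigl => i; rewrite inE.
  rewrite (_ : 2 * r = \sum_v (#|[pred i | mm.1 i == v]| + #|[pred i | mm.2 i == v]|))%N; last first.
    by rewrite big_split /= !sumr mul2n addnn.
  rewrite mulnC -sum_nat_const [leqRHS](bigID (mem (im mm.1 :|: im mm.2))) /=.
  apply: leq_trans (leq_addr _ _); apply: leq_sum => v vim.
  move: (deg v); have : (0 < #|[pred i | mm.1 i == v]| + #|[pred i | mm.2 i == v]|)%N.
    rewrite addn_gt0; case/setUP: vim => /imsetP[i _ ->]; apply/orP; [left|right];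
      by apply/card_gt0P; exists i; rewrite inE.
  move: #|_| #|_| => a b ab0; rewrite leqNgt => /eqP abl; apply/negP => ab1.
  case: a b ab0 ab1 abl => [|[|a]] [|[|b]] //= _; try lia; move=> _ /eqP.
    by rewrite mod0n modn_small.
  by rewrite mod0n modn_small.
pose U := \bigcup_(S in [set S : {set 'I_h} | #|S| == r])
  finset.setX [set m : {ffun 'I_r -> 'I_h} | m \in ffun_on (mem S)]
       [set m : {ffun 'I_r -> 'I_h} | m \in ffun_on (mem S)].
apply: (@leq_trans #|U|).
  apply: subset_leq_card; apply/fintype.subsetP => mm; rewrite inE => /small le_r.
  have [S imS Sr] : exists2 S : {set 'I_h}, im mm.1 :|: im mm.2 \subset S & #|S| = r.
    by apply: exists_superset_card => //; rewrite card_ord.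
  apply/bigcupP; exists S; first by rewrite inE Sr.
  rewrite !inE; apply/andP; split; apply/ffun_onP => i; apply: (fintype.subsetP imS);
    by rewrite inE imset_f ?orbT.
apply: (@leq_trans (\sum_(S in [set S : {set 'I_h} | #|S| == r]) r ^ (2 * r))).
  apply: leq_trans (leq_card_bigcup _ _) _; apply: leq_sum => S; rewrite inE => /eqP Sr.
  rewrite cardsX mul2n -addnn expnD.
  have -> : #|[set m : {ffun 'I_r -> 'I_h} | m \in ffun_on (mem S)]| = (r ^ r)%N.
    by rewrite cardsE card_ffun_on card_ord Sr.
  by [].
by rewrite sum_nat_const card_draws card_ord.
Qed.

Lemma Fp_expr_pred (p : nat) (y : 'F_p) : prime p -> y != 0 -> y ^+ p.-1 = 1.
Proof.
move=> p_pr y0; apply: (mulfI y0); rewrite mulr1 -exprS prednK ?prime_gt0 //.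
by rewrite -[RHS]expf_card card_Fp.
Qed.

(** Bernoulli's inequality [(1 - 1/h)^r >= 1 - r/h >= 20/21], with denominators cleared. *)
Lemma bernoulli_pred (h r : nat) : (21 * r <= h)%N -> (20 * h ^ r <= 21 * h.-1 ^ r)%N.
Proof.
case: h => [|h]; first by case: r.
have B k : ((h.+1 - k) * h.+1 ^ k <= h.+1 * h ^ k)%N.
  elim: k => [|k IHk]; first by rewrite subn0 !expn0.
  rewrite !expnSr; have := leq_mul IHk (leqnn h); rewrite -!mulnA => {IHk} /(leq_trans _); apply.
  move: (h.+1 ^ k)%N => X; rewrite subSS mulnA mulnAC mulnA [leqRHS]mulnAC leq_mul2r.
  by apply/orP; right; case: (leqP k h); nia.
move=> rh; rewrite -(@leq_pmul2l h.+1) // mulnCA [leqRHS]mulnCA.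
apply: leq_trans (leq_mul (leqnn 21) (B r)); rewrite !mulnA leq_mul2r; apply/orP; right; lia.
Qed.

(** * Variance of the coset counts of products of shifts *)

Section Moment.
Variables (R : realFieldType) (p l s r n h : nat).
Hypotheses (p_pr : prime p) (l_pr : prime l) (ep : p = (l * s).+1) (r_gt0 : (0 < r)%N).
Hypotheses (np : (n ^ 2 < p < n.+1 ^ 2)%N) (rn : (2 * (r ^ 2 + 6 * r + 3) <= n)%N).
Hypotheses (rh : (21 * r <= h)%N) (hp : (h <= p)%N).
Let tuple := {ffun 'I_r -> 'I_h}.
Let pt (x : 'F_p) (m : tuple) : 'F_p := \prod_i (x + (m i)%:R).
Let mu : {set 'F_p} := [set c | c ^+ l == 1].
Let w x c : R := #|[set m | pt x m ^+ s == c]|%:R.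
(** The [s]-th power labels the cosets of the [l]-th powers by [mu], and [w x c] counts the tuples
    whose product lies in coset [c]. [V x] is the sum of squared deviations of these counts: large
    when the [x + m] share a coset, small on average over [x]. *)
Let V x := \sum_(c in mu) w x c ^+ 2 - (\sum_(c in mu) w x c) ^+ 2 / l%:R.

Let l_gt1 : (1 < l)%N := prime_gt1 l_pr.
Let l_inv : 0 < (l%:R^-1 : R) <= 2^-1.
Proof. by rewrite invr_gt0 ltr0n ltnW //= lef_pV2 ?posrE ?ltr0n ?ltr_nat ?ler_nat // ltnW. Qed.

Let s_gt0 : (0 < s)%N.
Proof. by case: (s) ep p_pr => // ->; rewrite muln0. Qed.

Let pow_s_mu y : (y ^+ s \in mu) = (y != 0).
Proof.
rewrite inE -exprM; have [->|y0] := eqVneq y 0.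
  by rewrite expr0n muln_eq0 !eqn0Ngt s_gt0 ltnW // eq_sym oner_eq0.
by rewrite mulnC -[(l * s)%N]/((l * s).+1.-1) -ep Fp_expr_pred ?eqxx.
Qed.

Let card_mu : (#|mu| <= l)%N.
Proof.
rewrite cardE; apply: max_unity_roots (enum_uniq _); first exact: ltnW.
by apply/allP => c; rewrite mem_enum inE unity_rootE.
Qed.

Let V_ge0 x : 0 <= V x.
Proof.
have mu1 : 1 \in mu by rewrite inE expr1n.
apply: le_trans (variance_lower_bound (w x) l_gt1 card_mu mu1).
by rewrite divr_ge0 ?sqr_ge0 // subr_ge0; case/andP: l_inv => *; lra.
Qed.

(** One exceptional shift is allowed, namely the one where [u] may divide the numerator. The
    condition [c != 0] keeps the counted [x + m] away from zero. *)
Definition almost_constant_points : {set 'F_p} :=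
  [set x | [exists c, (c != 0) && (h.-1 <= #|[set m : 'I_h | ((x + m%:R) ^+ s == c)%R]|)%N]].

(** The [(h - 1)^r] tuples that avoid the exceptional shift all land on [c ^+ r], and they are at
    least [20/21] of all tuples, while the mean count is at most [h^r / l]. *)
Let V_good x : x \in almost_constant_points ->
  (1 - l%:R^-1) * ((19 / 21) ^+ 2 * (h%:R ^+ r) ^+ 2) <= V x.
Proof.
rewrite inE => /existsP[c /andP[c0]]; set A := [set m | _] => hA.
have cmu : c \in mu.
  have /card_gt0P[m] : (0 < #|A|)%N by lia.
  by rewrite inE => /eqP cE; rewrite -cE pow_s_mu;
    apply: contraNneq c0 => x0; rewrite -cE x0 expr0n eqn0Ngt s_gt0.
have c0mu : c ^+ r \in mu by move: cmu; rewrite !inE exprAC => /eqP ->; rewrite expr1n.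
apply: le_trans (variance_lower_bound (w x) l_gt1 card_mu c0mu).
have wc : ((h.-1 ^ r)%:R : R) <= w x (c ^+ r).
  rewrite ler_nat; apply: (@leq_trans #|[set m : tuple | m \in ffun_on (mem A)]|).
    by rewrite cardsE card_ffun_on card_ord leq_exp2r.
  apply: subset_leq_card; apply/fintype.subsetP => m; rewrite !inE => /ffun_onP mA.
  rewrite /pt -prodrXl; apply/eqP; rewrite (eq_bigr (fun=> c)) => [|i _].
    by rewrite prodr_const card_ord.
  by have := mA i; rewrite inE => /eqP.
have Th : \sum_(c in mu) w x c <= h%:R ^+ r.
  rewrite -natr_sum -natrX ler_nat -[leqRHS](_ : #|{: tuple}| = _); last by rewrite card_ffun !card_ord.
  rewrite -sum1_card (partition_big (fun m => pt x m ^+ s) xpredT) //=.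
  rewrite [leqRHS](bigID (mem mu)) /=; apply: leq_trans (leq_addr _ _).
  by apply: leq_sum => y _; rewrite -sum1_card; apply/eq_leq/eq_bigl => m; rewrite inE.
have hr : 20 / 21 * h%:R ^+ r <= w x (c ^+ r).
  apply: le_trans wc; have := bernoulli_pred rh.
  by rewrite -(ler_nat R) !natrM !natrX => ?; lra.
have H0 : 0 <= (h%:R : R) ^+ r by rewrite exprn_ge0.
move: (h%:R ^+ r) (w x (c ^+ r)) (\sum_(_ in _) _) H0 hr Th => H W T H0 hr Th.
case/andP: l_inv; move: (l%:R^-1) => t t0 t2.
rewrite ler_pdivlMr; last by lra.
have -> : (1 - t) * ((19 / 21) ^+ 2 * H ^+ 2) * (1 - t) = ((1 - t) * (19 / 21) * H) ^+ 2 by field.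
(* [20/21 - t >= 19/21 (1 - t)] amounts to [t <= 1/2]. *)
have H1 : (1 - t) * (19 / 21) * H <= W - T * t.
  have := ler_wpM2r (ltW t0) Th; have := ler_wpM2r H0 t2; lra.
by rewrite lerXn2r ?nnegrE // ?(le_trans _ H1) // mulr_ge0 // mulr_ge0 //; lra.
Qed.

Let ok x (m m' : tuple) := (pt x m != 0) && (pt x m' != 0).
Let eqs x (m m' : tuple) := pt x m ^+ s == pt x m' ^+ s.

Let V_pairs x : V x =
  \sum_m \sum_m' ((ok x m m' && eqs x m m')%:R - (ok x m m')%:R / l%:R).
Proof.
have wE c : w x c = \sum_m (pt x m ^+ s == c)%:R.
  by rewrite /w -sum1_card natr_sum big_mkcond; apply: eq_bigr => m _; rewrite inE; case: ifP.
under eq_bigr do rewrite sumrB -mulr_suml.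
rewrite sumrB -mulr_suml /V; congr (_ - _ / _).
  under eq_bigr do rewrite wE expr2 big_distrlr /=.
  rewrite exchange_big; apply: eq_bigr => m _; rewrite exchange_big; apply: eq_bigr => m' _ /=.
  rewrite /ok /eqs.
  have [y0|y0] := boolP (pt x m != 0); last first.
    rewrite big1 // => c cmu; case: eqP => [e|_]; last by rewrite mul0r.
    by move: cmu; rewrite -e pow_s_mu (negPf y0).
  rewrite (bigD1 (pt x m ^+ s)) ?pow_s_mu //= big1 ?addr0 => [|c /andP[_ /negPf nc]]; last first.
    by rewrite eq_sym nc mul0r.
  rewrite eqxx mul1r eq_sym; case: eqP => e; last by rewrite andbF.
  by rewrite -pow_s_mu -e pow_s_mu y0.
have -> : \sum_(c in mu) w x c = \sum_m (pt x m != 0)%:R.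
  under eq_bigr do rewrite wE.
  rewrite exchange_big; apply: eq_bigr => m _ /=.
  have [y0|y0] := boolP (pt x m != 0); last first.
    rewrite big1 // => c cmu; case: eqP => [e|//].
    by move: cmu; rewrite -e pow_s_mu (negPf y0).
  rewrite (bigD1 (pt x m ^+ s)) ?pow_s_mu //= big1 ?addr0 ?eqxx // => c /andP[_ /negPf nc].
  by rewrite eq_sym nc.
rewrite expr2 big_distrlr; apply: eq_bigr => m _; apply: eq_bigr => m' _ /=.
by rewrite -natrM mulnb.
Qed.

Let sum_ok m m' : \sum_x (ok x m m')%:R = #|[set x | ok x m m']|%:R :> R.
Proof. by rewrite -sum1_card natr_sum [RHS]big_mkcond; apply: eq_bigr => x _; rewrite inE; case: ifP. Qed.

Let card_ok m m' : (p <= #|[set x | ok x m m']| + 2 * r)%N.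
Proof.
rewrite -{1}(card_Fp p_pr) -(cardsC [set x | ok x m m']) leq_add2l.
pose Z (m : tuple) := [set - ((m i : nat)%:R : 'F_p) | i : 'I_r].
have Zr m0 : (#|Z m0| <= r)%N by rewrite (leq_trans (leq_imset_card _ _)) // card_ord.
apply: (@leq_trans #|Z m :|: Z m'|); last first.
  by apply: leq_trans (leq_card_setU _ _) _; rewrite mul2n -addnn leq_add.
have inZ x m0 : pt x m0 == 0 -> x \in Z m0.
  move=> /prodf_eq0[i _]; rewrite addr_eq0 => /eqP ->; exact: imset_f.
apply: subset_leq_card; apply/fintype.subsetP => x; rewrite !inE negb_and !negbK.
by case/orP => /inZ ->; rewrite ?orbT.
Qed.

Let card_le_p (A : {set 'F_p}) : (#|A| <= p)%N.
Proof. by rewrite -[leqRHS](card_Fp p_pr) max_card. Qed.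

(** For a nondegenerate pair the main term [p / l] of [card_agree] cancels against the subtracted
    mean, which is at least [(p - 2 r) / l]. The count enters with a positive sign only, so an upper
    bound for it is enough. *)
Let sum_pair m m' :
  \sum_x ((ok x m m' && eqs x m m')%:R - (ok x m m')%:R / l%:R) <=
  (if degenerate l m m' then (1 - l%:R^-1) * p%:R
   else (2 * r + 1)%:R * n%:R + (2 * r)%:R / l%:R :> R).
Proof.
have l0 : 0 < (l%:R : R) by rewrite ltr0n ltnW.
case/andP: l_inv => t0 t2; rewrite sumrB -mulr_suml sum_ok.
have -> : \sum_x (ok x m m' && eqs x m m')%:R = #|[set x | ok x m m' && eqs x m m']|%:R :> R.
  by rewrite -sum1_card natr_sum [RHS]big_mkcond; apply: eq_bigr => x _; rewrite inE; case: ifP.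
case: ifPn => [_|/forallPn[v nondeg]].
  have : (#|[set x | ok x m m' && eqs x m m']|%:R : R) <= #|[set x | ok x m m']|%:R.
    by rewrite ler_nat subset_leq_card //; apply/fintype.subsetP => x; rewrite !inE => /andP[].
  have : (#|[set x | ok x m m']|%:R : R) <= p%:R by rewrite ler_nat card_le_p.
  move: (#|[set x | ok x m m']|%:R) (#|[set x | ok x m m' && eqs x m m']|%:R) => a b ap ba.
  have : (1 - l%:R^-1) * a <= (1 - l%:R^-1) * p%:R by rewrite ler_wpM2l //; lra.
  lra.
have cnt (m0 : tuple) : #|[pred i | - ((m0 i : nat)%:R : 'F_p) == - (v : nat)%:R]| = #|[pred i | m0 i == v]|.
  apply: eq_card => i; rewrite !inE eqr_opp; apply/eqP/eqP => [eij|->//].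
  by apply/val_inj; apply: (natr_Fp_inj eij p_pr); apply: leq_trans (ltn_ord _) hp.
have := @card_agree p l s r n (fun i => - (m i : nat)%:R) (fun i => - (m' i : nat)%:R)
  (- (v : nat)%:R) p_pr l_pr ep r_gt0 np rn.
rewrite !cnt => /(_ nondeg).
rewrite (_ : [set x : 'F_p | _] = [set x | ok x m m' && eqs x m m']); last first.
  apply/setP => x; rewrite !inE -andbA.
  have e (m0 : tuple) : \prod_i (x - - (m0 i : nat)%:R) = pt x m0.
    by apply: eq_bigr => i _; rewrite opprK.
  by rewrite !e.
rewrite -(ler_nat R) natrM natrD natrM; have := card_ok m m'.
rewrite -(ler_nat R) natrD; 
move: (#|[set x | ok x m m']|%:R) (#|[set x | ok x m m' && eqs x m m']|%:R) => u N up lN.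
have -> : N = l%:R * N / l%:R by rewrite mulrAC divff ?mul1r // gt_eqF.
rewrite -mulrBl ler_pdivrMr // mulrDl divfK ?gt_eqF //; lra.
Qed.

(** Both sides bound the sum of [V x] over all [x]: from below by dropping the other points, where
    [V x >= 0], from above pair by pair. The factor [1 - 1/l] is then divided out; being at least
    [1/2], it doubles the nondegenerate term at worst. *)
Lemma card_almost_constant_points :
  #|almost_constant_points|%:R * (19 / 21) ^+ 2 * (h%:R ^+ r) ^+ 2 <=
    ('C(h, r) * r ^ (2 * r))%:R * p%:R + (h%:R ^+ r) ^+ 2 * (2 * (2 * r + 1) * n + 2 * r)%:R :> R.
Proof.
case/andP: l_inv => t0 t2.
have H0 : 0 <= ((h%:R : R) ^+ r) ^+ 2 by rewrite sqr_ge0.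
have lower : #|almost_constant_points|%:R * ((1 - l%:R^-1) * ((19 / 21) ^+ 2 * (h%:R ^+ r) ^+ 2)) <= \sum_x V x.
  rewrite (bigID (mem almost_constant_points)) /= -[leLHS]addr0 lerD //.
    by rewrite mulr_natl -sumr_const; apply: ler_sum => x /V_good.
  by apply: sumr_ge0 => x _; exact: V_ge0.
have upper : \sum_x V x <= ('C(h, r) * r ^ (2 * r))%:R * ((1 - l%:R^-1) * p%:R) +
    (h%:R ^+ r) ^+ 2 * ((2 * r + 1)%:R * n%:R + (2 * r)%:R / l%:R).
  under eq_bigr do rewrite V_pairs.
  rewrite exchange_big; under eq_bigr do rewrite exchange_big.
  set C := _ * n%:R + _; set P := _ * p%:R.
  have C0 : 0 <= C by rewrite addr_ge0 // mulr_ge0 // ltW.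
  have P0 : 0 <= P by rewrite mulr_ge0 // subr_ge0; lra.
  rewrite pair_big /=.
  apply: (@le_trans _ _ (\sum_(mm : tuple * tuple) ((degenerate l mm.1 mm.2)%:R * P + C))).
    by apply: ler_sum => -[m m'] _; apply: le_trans (sum_pair m m') _ ; case: (degenerate l m m') => /=; rewrite -/P -/C; lra.
  rewrite big_split /= lerD //; last first.
    by rewrite sumr_const card_prod card_ffun !card_ord -(mulr_natl C) natrM natrX expr2 lexx.
  rewrite -mulr_suml ler_wpM2r // -natr_sum ler_nat.
  apply: leq_trans (card_degenerate l_gt1 (_ : r <= h)%N); last by move: rh; clear; lia.
  by rewrite -sum1_card [leqRHS]big_mkcond /=; apply: leq_sum => mm _; rewrite inE; case: ifP.
have := le_trans lower upper => le1.
have t1 : 0 < 1 - (l%:R^-1 : R) by lra.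
rewrite -(ler_pM2l t1) !(natrD _ (2 * (2 * r + 1) * n)) (natrM _ (2 * (2 * r + 1))) (natrM _ 2 (2 * r + 1)).
move: le1; rewrite natrD (natrM _ 2 r).
move: (#|almost_constant_points|%:R) ('C(h, r) * r ^ (2 * r))%:R ((h%:R ^+ r) ^+ 2) H0 => G c H H0 le1.
have r0 : 0 <= (r%:R : R) by [].
have n0 : 0 <= (n%:R : R) by [].
have K : (1 - l%:R^-1) * (2 * (2 * r%:R + 1) * n%:R + 2 * r%:R) >=
   (2 * r%:R + 1) * n%:R + 2 * r%:R * l%:R^-1 :> R.
  have A0 : 0 <= (2 * r%:R + 1) * n%:R :> R by rewrite mulr_ge0 // addr_ge0 // mulr_ge0.
  have := ler_wpM2r A0 t2; have := ler_wpM2r r0 t2; lra.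
have := ler_wpM2l H0 K; lra.
Qed.
End Moment.

(** * Counting fractions *)

(** A pair [qv = (q, v)] encodes the fraction [v / q] whose progression [v, v + q, ..., v + k q]
    stays in [[1, n]]. *)
Definition triangle (k n : nat) : {set 'I_n.+1 * 'I_n.+1} :=
  [set qv : 'I_n.+1 * 'I_n.+1 | [&& (0 < qv.1)%N, (0 < qv.2)%N & (qv.2 + k * qv.1 <= n)%N]].

Lemma sum_ord_gt0 (n : nat) (P : pred nat) (F : nat -> nat) :
  (\sum_(i < n.+1 | (0 < i)%N && P i) F i = \sum_(1 <= i < n.+1 | P i) F i)%N.
Proof.
rewrite -(big_mkord (fun i => (0 < i)%N && P i)) big_ltn_cond //= big_nat_cond [RHS]big_nat_cond.
by apply: eq_bigl => i; case: i.
Qed.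

Lemma card_triangle (k n : nat) : (0 < k)%N ->
  #|triangle k n| = (\sum_(1 <= q < n.+1) (n - k * q))%N.
Proof.
move=> k0; rewrite -sum1_card.
rewrite (eq_bigl (fun qv : 'I_n.+1 * 'I_n.+1 =>
  (0 < qv.1)%N && ((0 < qv.2)%N && (qv.2 + k * qv.1 <= n)%N))) => [|qv]; last by rewrite inE.
rewrite -(pair_big_dep (fun q : 'I_n.+1 => (0 < q)%N)
  (fun q v : 'I_n.+1 => (0 < v)%N && (v + k * q <= n)%N) (fun _ _ => 1%N)) /=.
rewrite -(sum_ord_gt0 n xpredT (fun q => n - k * q)%N).
apply: eq_big => [q|q q0]; first by rewrite andbT.
rewrite (sum_ord_gt0 n (fun v => v + k * q <= n)%N (fun=> 1%N)).
rewrite -[RHS]muln1 -[(n - k * q)%N]subn0 -sum_nat_const_nat big_add1 /= big_mkcond /=.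
rewrite [LHS]big_nat_cond [RHS](big_nat_widen _ _ n) ?leq_subr //= -big_mkcondr.
by apply: eq_bigl => v; rewrite andbT ltn_subRL; apply/idP/idP; move: (k * q)%N; lia.
Qed.


Lemma sum_triangle_step (k n : nat) : (0 < k)%N ->
  (\sum_(1 <= q < (n + k).+1) (n + k - k * q) = n + \sum_(1 <= q < n.+1) (n - k * q))%N.
Proof.
move=> k0; rewrite big_ltn ?ltnS ?addn_gt0 ?k0 ?orbT // muln1 addnK; congr addn.
rewrite big_add1 /= (@big_cat_nat _ _ _ n.+1) //=; last by lia.
rewrite [X in (_ + X)%N]big_nat_cond [X in (_ + X)%N]big1 ?addn0 => [|q /andP[/andP[nq _] _]].
  by apply: eq_bigr => q _; rewrite mulnS; lia.
by apply/eqP; rewrite subn_eq0; nia.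
Qed.

(** The area is [n^2 / (2 k)]. Induction in steps of [k]: the row [q = 1] has [n - k] points, and
    the other rows form the triangle of size [n - k]. *)
Lemma triangle_bounds (k n : nat) : (0 < k)%N ->
  (n ^ 2 <= 2 * k * #|triangle k n| + k * n)%N /\ (2 * k * #|triangle k n| <= n ^ 2)%N.
Proof.
move=> k0; rewrite card_triangle //.
have [m] := ubnP n; elim: m n => // m IHm n; rewrite ltnS => nm.
have [kn|nk] := leqP k n; last first.
  rewrite big_nat_cond big1 ?muln0 => [|q /andP[/andP[q1 _] _]]; last by apply/eqP; rewrite subn_eq0; nia.
  by split=> //; rewrite expnS expn1 add0n leq_mul2r ltnW // orbT.
have [|h1 h2] := IHm (n - k)%N; first by lia.
rewrite -(subnK kn) sum_triangle_step //; move: (n - k)%N (bigop.body _ _ _) h1 h2 => a S h1 h2.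
split; nia.
Qed.

Definition coprime_triangle (k n : nat) := [set qv in triangle k n | coprime qv.1 qv.2].

Lemma card_triangle_dvd (k n d : nat) : (0 < d)%N ->
  (#|[set qv in triangle k n | (d %| qv.1) && (d %| qv.2)]| <= #|triangle k (n %/ d)|)%N.
Proof.
move=> d0; set A := [set qv in _ | _].
pose f (qv : 'I_n.+1 * 'I_n.+1) : 'I_(n %/ d).+1 * 'I_(n %/ d).+1 :=
  (inord (qv.1 %/ d), inord (qv.2 %/ d)).
have fE qv : ((f qv).1 = (qv.1 %/ d)%N :> nat) /\ ((f qv).2 = (qv.2 %/ d)%N :> nat).
  by rewrite /f /= !inordK // ltnS leq_div2r // -ltnS ltn_ord.
rewrite -(@card_in_imset _ _ f) => [|qv qv']; last first.
  rewrite !inE => /andP[_ /andP[d1 d2]] /andP[_ /andP[d1' d2']] eqf.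
  have [e1 e2] := fE qv; have [e1' e2'] := fE qv'.
  have E1 : qv.1 = qv'.1 by apply/val_inj; rewrite /= -(divnK d1) -(divnK d1') -e1 -e1' eqf.
  have E2 : qv.2 = qv'.2 by apply/val_inj; rewrite /= -(divnK d2) -(divnK d2') -e2 -e2' eqf.
  by case: qv qv' E1 E2 {d1 d2 d1' d2' eqf e1 e2 e1' e2'} => ? ? [? ?] /= -> ->.
apply: subset_leq_card; apply/fintype.subsetP => _ /imsetP[qv + ->]; rewrite !inE.
have [-> ->] := fE qv; move: (val qv.1) (val qv.2) => q v.
case/andP=> /and3P[q0 v0 le_n] /andP[/dvdnP[a eq] /dvdnP[b ev]].
move: q0 v0 le_n; rewrite eq ev !mulnK // !muln_gt0 => /andP[-> _] /andP[-> _] le_n /=.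
by rewrite leq_divRL // mulnDl -mulnA.
Qed.

(** Telescoping: [(2 j + 1)^2 >= 4 j (j + 1)], so each term is at most [1/(4 j) - 1/(4 (j + 1))]. *)
Lemma sum_inv_odd_sqr (R : realFieldType) (n : nat) :
  \sum_(1 <= j < n.+1) ((2 * j + 1)%:R ^- 2) <= 4^-1 :> R.
Proof.
suff : \sum_(1 <= j < n.+1) ((2 * j + 1)%:R ^- 2) <= 4^-1 - (4 * n.+1%:R)^-1 :> R.
  by move/le_trans; apply; rewrite gerBl invr_ge0 mulr_ge0.
elim: n => [|n IHn]; first by rewrite big_geq // mulr1 subrr.
rewrite big_nat_recr //=; apply: le_trans (lerD IHn (lexx _)) _.
rewrite natrD natrM -(natr1 n.+1) -(natr1 n); have : 0 <= (n%:R : R) by [].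
move: (n%:R) => x x0.
rewrite -subr_ge0.
rewrite [leRHS](_ : _ = (4 * (x + 1) * (x + 1 + 1) * (2 * (x + 1) + 1) ^+ 2)^-1).
  by rewrite invr_ge0; nra.
by field; rewrite ?expf_neq0 ?gt_eqF //; lra.
Qed.

(* A pair that is not coprime has a common divisor that is 2 or odd, and
   [1/2^2 + 1/3^2 + 1/5^2 + 1/7^2 + ... <= 1/2]. *)
Lemma card_coprime_triangle (k n : nat) : (0 < k)%N ->
  (n ^ 2 <= 4 * k * #|coprime_triangle k n| + 2 * k * n)%N.
Proof.
move=> k0.
pose B d := [set qv in triangle k n | (d %| qv.1)%N && (d %| qv.2)%N].
have cover : triangle k n \subset
    (coprime_triangle k n :|: B 2) :|: \bigcup_(j < n.+1 | (0 < j)%N) B (2 * j + 1)%N.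
  apply/fintype.subsetP => qv; rewrite inE => /and3P[q0 v0 le_n]; rewrite /B !inE q0 v0 le_n /=.
  have [//|ncop] := boolP (coprime qv.1 qv.2).
  pose d := pdiv (gcdn qv.1 qv.2).
  have d_pr : prime d by rewrite pdiv_prime // ltn_neqAle eq_sym ncop gcdn_gt0 q0.
  have dq : (d %| qv.1)%N by rewrite (dvdn_trans (pdiv_dvd _)) // dvdn_gcdl.
  have dv : (d %| qv.2)%N by rewrite (dvdn_trans (pdiv_dvd _)) // dvdn_gcdr.
  have [d2|dodd] := even_prime d_pr; first by rewrite d2 in dq dv; rewrite dq dv.
  have dn : (d./2 < n.+1)%N.
    by rewrite -divn2 (leq_ltn_trans (leq_div _ _)) // (leq_ltn_trans (dvdn_leq q0 dq)).
  apply/orP; right; apply/bigcupP; exists (Ordinal dn); rewrite /=.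
    by rewrite half_gt0 prime_gt1.
  have ed : (2 * d./2 + 1 = d)%N by rewrite -[RHS]odd_double_half dodd mul2n addnC.
  by rewrite ed !inE q0 v0 le_n dq dv.
rewrite -(ler_nat rat) natrX natrD !natrM.
have [lo _] := triangle_bounds n k0.
have up d : (0 < d)%N -> 2 * k%:R * #|B d|%:R <= (n%:R / d%:R) ^+ 2 :> rat.
  move=> d0; have [_ h2] := triangle_bounds (n %/ d) k0.
  have := leq_trans (leq_mul (leqnn (2 * k)) (card_triangle_dvd k n d0)) h2.
  rewrite -(ler_nat rat) natrX natrM natrM => /le_trans; apply.
  by rewrite lerXn2r ?nnegrE ?divr_ge0 // ler_pdivlMr ?ltr0n // -natrM ler_nat leq_trunc_div.
have cov : #|triangle k n|%:R <= #|coprime_triangle k n|%:R + #|B 2|%:R +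
    \sum_(1 <= j < n.+1) #|B (2 * j + 1)%N|%:R :> rat.
  rewrite -natr_sum -!natrD ler_nat; apply: leq_trans (subset_leq_card cover) _.
  apply: leq_trans (leq_card_setU _ _) _; apply: leq_add (leq_card_setU _ _) _.
  apply: leq_trans (leq_card_bigcup _ _) _.
  by rewrite -(sum_ord_gt0 n xpredT (fun j => #|B (2 * j + 1)%N|)); apply/eq_leq/eq_bigl => j; rewrite andbT.
have h2 := up 2 isT.
have h3 : 2 * k%:R * (\sum_(1 <= j < n.+1) #|B (2 * j + 1)%N|%:R) <= n%:R ^+ 2 * 4^-1 :> rat.
  apply: le_trans (ler_wpM2l (sqr_ge0 _) (sum_inv_odd_sqr _ n)).
  rewrite !mulr_sumr; apply: ler_sum => j _.
  by apply: le_trans (up _ _) _; rewrite ?addn1 // exprMn exprVn.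
move: lo; rewrite -(ler_nat rat) natrX natrD !natrM => lo.
have : 2 * k%:R * #|triangle k n|%:R <= 2 * k%:R * (#|coprime_triangle k n|%:R + #|B 2|%:R +
    \sum_(1 <= j < n.+1) #|B (2 * j + 1)%N|%:R) :> rat by rewrite ler_wpM2l // mulr_ge0.
move: h2 h3; rewrite exprMn; lra.
Qed.

(** * Fractions as almost constant points *)

Section FractionPoints.
Variables (p s k H u : nat).
Hypotheses (p_pr : prime p) (s_gt0 : (0 < s)%N) (k_gt0 : (0 < k)%N) (u_pr : prime u) (ku : (k < u)%N).
Hypothesis (Hp : (2 * H ^ 2 < k * p)%N) (HltP : (H < p)%N).
Hypothesis res : forall v : nat, (0 < v <= H)%N -> ~~ (u %| v)%N -> (v%:R : 'F_p) ^+ s = 1.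

Let frac (qv : 'I_H.+1 * 'I_H.+1) : 'F_p := (qv.2 : nat)%:R / (qv.1 : nat)%:R.

Let natr_neq0 (q : nat) : (0 < q <= H)%N -> (q%:R : 'F_p) != 0.
Proof. by case/andP=> q0 qH; rewrite natr_Fp_eq0 // gtnNdvd // (leq_ltn_trans qH). Qed.

Let frac_good qv : qv \in coprime_triangle k H -> frac qv \in almost_constant_points p s k.+1.
Proof.
rewrite !inE => /andP[/and3P[q0 v0 le_n] cop]; apply/existsP.
have qH : (qv.1 <= H)%N by rewrite -ltnS.
have nq : ((qv.1 : nat)%:R : 'F_p) != 0 by rewrite natr_neq0 // q0.
exists ((qv.1 : nat)%:R ^- s); rewrite invr_eq0 expf_neq0 //= .
set A := [set m | _].
pose Bad := [set m : 'I_k.+1 | (u %| qv.2 + m * qv.1)%N].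
have AB : ~: Bad \subset A.
  apply/fintype.subsetP => m; rewrite !inE => nbad.
  have -> : frac qv + (m : nat)%:R = (qv.2 + m * qv.1)%:R / (qv.1 : nat)%:R.
    by rewrite natrD natrM mulrDl mulfK.
  rewrite expr_div_n res // ?mul1r // addn_gt0 v0 /= (leq_trans _ le_n) // leq_add2l leq_mul2r.
  by rewrite -ltnS ltn_ord orbT.
(* If [u] divided two of the numerators, it would divide [(m' - m) q], hence [q] because [k < u],
   hence also [v], against coprimality. *)
have Bad1 : (#|Bad| <= 1)%N.
  apply/card_le1_eqP => m m'; rewrite !inE.
  wlog: m m' / (m <= m')%N => [hw bm bm'|mm' bm bm'].
    by case/orP: (leq_total m m') => [/hw|/hw e]; [apply|rewrite -e].
  apply/val_inj/eqP; rewrite eqn_leq mm' /= -subn_eq0 ?andbT; apply/negPn/negP => d0.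
  have : (u %| (m' - m) * qv.1)%N.
    by rewrite mulnBl -(subnDl qv.2) dvdn_sub.
  rewrite Euclid_dvdM // => /orP[/dvdn_leq|uq].
    by rewrite lt0n => /(_ d0); have := ltn_ord m'; move: ku (val m) (val m'); clear; lia.
  have : (u %| gcdn qv.1 qv.2)%N.
    by rewrite dvdn_gcd uq /=; move: bm; rewrite dvdn_addl // dvdn_mull.
  by rewrite (eqP cop) dvdn1 gtn_eqF // prime_gt1.
apply: leq_trans (subset_leq_card AB).
have := cardsC Bad; rewrite card_ord; lia.
Qed.

(** Reversing the order of the shifts, [- x - k + (k - m) = - (x + m)], multiplies all [s]-th powers
    by the same sign. *)
Let reflect_good x : x \in almost_constant_points p s k.+1 ->
  - x - k%:R \in almost_constant_points p s k.+1.
Proof.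
rewrite !inE => /existsP[c /andP[c0 hc]]; apply/existsP; exists ((-1) ^+ s * c).
rewrite mulf_neq0 ?expf_neq0 ?oppr_eq0 ?oner_eq0 //=; apply: leq_trans hc _.
rewrite -(card_imset _ (@rev_ord_inj k.+1)); apply: subset_leq_card.
apply/fintype.subsetP => _ /imsetP[m + ->]; rewrite !inE => /eqP <-.
have mk : (m <= k)%N by rewrite -ltnS.
have -> : (nat_of_ord (rev_ord m))%:R = k%:R - (nat_of_ord m)%:R :> 'F_p.
  by rewrite /= subSS natrB.
by rewrite -exprMn mulN1r opprD addrA subrK.
Qed.

(** From [k q <= H] and [2 H^2 < k p], each product [v q'] is below [p / 2]. Hence equality of two
    fractions mod [p] is equality of integers, and no fraction is the reflection of another, since
    [v q' + (v' + k q') q] lies strictly between [0] and [p]. *)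
Lemma card_almost_constant_ge :
  (2 * #|coprime_triangle k H| <= #|almost_constant_points p s k.+1|)%N.
Proof.
have bnd qv : qv \in coprime_triangle k H ->
    [/\ (0 < qv.1 <= H)%N, (0 < qv.2)%N, (qv.2 + k * qv.1 <= H)%N & coprime qv.1 qv.2].
  by rewrite !inE => /andP[/and3P[-> -> ->] ->]; rewrite -ltnS ltn_ord.
have prod_lt (a b : nat) : (a <= H)%N -> (k * b <= H)%N -> (2 * (a * b) < p)%N.
  move=> aH kb; rewrite -(ltn_pmul2l k_gt0); apply: leq_ltn_trans Hp.
  by have := leq_mul aH kb; rewrite -mulnn; lia.
have finj : {in coprime_triangle k H &, injective frac}.
  move=> qv qv' /bnd[q0 v0 le_n cop] /bnd[q0' v0' le_n' cop'] /eqP.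
  rewrite /frac eqr_div ?natr_neq0 // -!natrM => /eqP/natr_Fp_inj e.
  have {}e : (qv.2 * qv'.1 = qv'.2 * qv.1)%N.
    apply: e => //.
      apply: leq_ltn_trans (prod_lt _ _ (leq_trans (leq_addr _ _) le_n) (leq_trans (leq_addl _ _) le_n')).
      exact: leq_pmull.
    apply: leq_ltn_trans (prod_lt _ _ (leq_trans (leq_addr _ _) le_n') (leq_trans (leq_addl _ _) le_n)).
    exact: leq_pmull.
  have e1 : qv.1 = qv'.1.
    apply/val_inj/eqP; rewrite eqn_dvd /=.
    rewrite -(@Gauss_dvdr _ qv.2) // e dvdn_mull //= -(@Gauss_dvdr _ qv'.2) //.
    by rewrite -e dvdn_mull.
  have e2 : qv.2 = qv'.2.
    apply/val_inj/eqP; rewrite -(@eqn_pmul2r qv'.1); last by case/andP: q0'.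
    by rewrite e e1.
  by case: qv qv' e1 e2 {q0 v0 le_n cop q0' v0' le_n' cop' e} => ? ? [? ?] /= -> ->.
pose C1 := frac @: coprime_triangle k H.
pose C2 := (fun x => - x - k%:R) @: C1.
have dis : C1 :&: C2 = finset.set0.
  apply/setP => x; rewrite !inE; apply/negP => /andP[/imsetP[qv /bnd[q0 v0 le_n _] ->]].
  case/imsetP => _ /imsetP[qv' /bnd[q0' v0' le_n' _] ->] /eqP.
  have nq : ((qv.1 : nat)%:R : 'F_p) != 0 by rewrite natr_neq0.
  have nq' : ((qv'.1 : nat)%:R : 'F_p) != 0 by rewrite natr_neq0.
  rewrite -opprD -addr_eq0 {1}/frac.
  have -> : frac qv' + k%:R = (qv'.2 + k * qv'.1)%:R / (qv'.1 : nat)%:R.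
    by rewrite natrD natrM mulrDl mulfK.
  rewrite addf_div // mulf_eq0 invr_eq0 mulf_eq0 (negPf nq) (negPf nq') !orbF -!natrM -natrD.
  rewrite natr_Fp_eq0 // gtnNdvd //.
    by rewrite addn_gt0 muln_gt0 v0; case/andP: q0' => ->.
  have add_lt (a b : nat) : (2 * a < p -> 2 * b < p -> a + b < p)%N by clear; lia.
  apply: add_lt.
    exact: prod_lt (leq_trans (leq_addr _ _) le_n) (leq_trans (leq_addl _ _) le_n').
  exact: prod_lt le_n' (leq_trans (leq_addl _ _) le_n).
have c1 : #|C1| = #|coprime_triangle k H| by rewrite card_in_imset.
have c2 : #|C2| = #|coprime_triangle k H|.
  by rewrite card_imset // => x y /addIr/oppr_inj.
rewrite mul2n -addnn -{1}c1 -c2 -cardsUI dis cards0 addn0; apply: subset_leq_card.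
apply/fintype.subsetP => x; rewrite inE => /orP[].
  by case/imsetP => qv /frac_good + ->.
by case/imsetP => _ /imsetP[qv /frac_good + ->] ->; exact: reflect_good.
Qed.
End FractionPoints.

(** * Characters *)

Section CharacterKernel.
Variables (R : realType) (p : nat) (chi : int -> R[i]).
Hypotheses (p_pr : prime p) (chiD : dirichlet_character p chi).

Let chi_addM (n : int) (j : nat) : chi (n + (p * j)%:Z) = chi n.
Proof.
case: chiD => chip _ _; elim: j => [|j IHj]; first by rewrite muln0 addr0.
by rewrite mulnS addnC PoszD addrA chip.
Qed.

Let chi_modn (n : nat) : chi (n %% p)%N%:Z = chi n%:Z.
Proof. by rewrite [in RHS](divn_eq n p) addnC PoszD mulnC chi_addM. Qed.

Let chi1 : chi 1 = 1.
Proof.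
case: chiD => _ chiM chi0.
have c1 : chi 1 != 0 by apply/chi0; rewrite -[coprimez _ _]/(coprime 1 p) coprime1n.
by apply: (mulfI c1); rewrite -chiM !mulr1.
Qed.

Let ker : {set {unit 'F_p}} := [set x | chi (((val x : 'F_p) : nat)%:Z) == 1].

Let group_set_ker : group_set ker.
Proof.
apply/group_setP; split.
  by rewrite inE -[val _]/(1 : 'F_p) -[1]/(1%:R) val_Fp_nat // chi_modn chi1.
move=> x y; rewrite !inE => /eqP cx /eqP cy.
have -> : val (x * y)%g = (((val x : 'F_p) : nat) * ((val y : 'F_p) : nat))%:R :> 'F_p.
  by rewrite natrM !natr_Zp.
by rewrite val_Fp_nat // chi_modn PoszM; case: chiD => _ -> _; rewrite cx cy mulr1.
Qed.

Let kerG := Group group_set_ker.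

(** The kernel of [chi] is a proper subgroup of the units. For a prime factor [l] of its index,
    [s = (p - 1) / l] is a multiple of the order of the kernel, which therefore has exponent
    dividing [s]. *)
Lemma character_kernel_residues : chi <> principal_character R p ->
  exists l s, [/\ prime l, p = (l * s).+1 &
    forall n : nat, chi n%:Z = 1 -> (n%:R : 'F_p) ^+ s = 1].
Proof.
move=> nprinc; have [_ _ chi0] := chiD.
have cop0 n : (0%R != (n%:R : 'F_p)) = coprime n p.
  by rewrite eq_sym natr_Fp_eq0 // -prime_coprime // coprime_sym.
have unitn n : coprime n p -> (n%:R : 'F_p) \is a GRing.unit.
  by move=> np; rewrite unitfE eq_sym cop0.
have inker n (np : coprime n p) : (FinRing.Unit (unitn n np) \in kerG) = (chi n%:Z == 1).
  by rewrite inE /= val_Fp_nat // chi_modn.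
have proper : kerG \proper [set: {unit 'F_p}].
  rewrite properT; apply/eqP => kerT; apply: nprinc; apply/funext => n.
  rewrite /principal_character; case: ifPn => [cop|ncop]; last first.
    by apply/eqP/negPn/negP => /chi0; apply/negP.
  have [m em] : exists m : nat, n + (p * `|n|%N)%N%:Z = m%:Z.
    exists (absz (n + (p * `|n|%N)%N%:Z)); rewrite gez0_abs //.
    have := prime_gt0 p_pr; rewrite PoszM; nia.
  rewrite -(chi_addM n `|n|%N) em; apply/eqP.
  have cm : coprime m p.
    rewrite -[coprime m p]/(coprimez m%:Z p%:Z) -em PoszM.
    by rewrite /coprimez gcdzC addrC mulrC gcdzMDl gcdzC.
  by rewrite -inker kerT inE.
have cardU : #|[set: {unit 'F_p}]| = p.-1 by rewrite card_finField_unit card_Fp.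
have idx1 : (1 < #|[set: {unit 'F_p}] : kerG|%g)%N by rewrite indexg_gt1 proper_subn.
have Lag := Lagrange (finset.subsetT kerG); rewrite cardU in Lag.
set d := #|_ : _|%g in idx1 Lag.
exists (pdiv d), (#|kerG| * (d %/ pdiv d))%N; split; first exact: pdiv_prime.
  by rewrite mulnCA mulnC [(pdiv d * _)%N]mulnC divnK ?pdiv_dvd // mulnC Lag prednK ?prime_gt0.
move=> n cn; have cop : coprime n p by apply/(chi0 n%:Z); rewrite cn oner_eq0.
have : FinRing.Unit (unitn n cop) \in kerG by rewrite inker cn.
move/expg_cardG/(congr1 val); rewrite FinRing.val_unitX /= => e.
by rewrite exprM e expr1n.
Qed.
End CharacterKernel.

(** * Numerical estimates *)

Lemma MVT_everywhere (R : realType) (F F' : R -> R) (b : R) :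
  0 < b -> (forall x : R, is_derive x 1 F (F' x)) ->
  exists2 c, 0 < c < b & F b - F 0 = F' c * b.
Proof.
move=> b0 dF; have [|c cb Fb] := @MVT R F F' 0 b b0 (fun x _ => dF x).
  apply: continuous_subspaceT => x; apply/differentiable_continuous/derivable1_diffP.
  exact: ex_derive.
by exists c; [rewrite in_itv /= in cb|rewrite Fb subr0].
Qed.

Lemma sin_le_id (R : realType) (x : R) : 0 < x -> sin x <= x.
Proof.
move=> x0.
have dF (y : R) : is_derive y 1 (fun y => y - sin y) (1 - cos y) by exact: is_derive_eq.
have [c _] := MVT_everywhere x0 dF; rewrite sin0 !subr0 => E.
by rewrite -subr_ge0 E mulr_ge0 ?(ltW x0) // subr_ge0 cos_le1.
Qed.

Lemma mul_cos_le_sin (R : realType) (x : R) : 0 < x < pi -> x * cos x <= sin x.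
Proof.
move=> /andP[x0 xpi].
have dF (y : R) : is_derive y 1 (fun y => sin y - y * cos y) (y * sin y).
  by apply: is_derive_eq; rewrite /GRing.scale /=; ring.
have [c /andP[c0 cx]] := MVT_everywhere x0 dF.
rewrite sin0 mul0r subr0 subr0 => E; rewrite -subr_ge0 E !mulr_ge0 ?ltW //.
by apply: sin_gt0_pi; rewrite c0 (lt_trans cx).
Qed.

(** From [cos (3 t) = 4 cos(t)^3 - 3 cos t = 0] at [t = pi / 6]. *)
Lemma cos_sin_pi6 (R : realType) :
  [/\ (0 : R) < cos (pi / 6), cos (pi / 6) ^+ 2 = 3 / 4 :> R & sin (pi / 6) = 1 / 2 :> R].
Proof.
have pi0 := pi_gt0 R; set t : R := pi / 6.
have c0 : 0 < cos t by apply: cos_gt0_pihalf; rewrite /t; lra.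
have s0 : 0 < sin t by apply: sin_gt0_pihalf; rewrite /t; lra.
have cs := cos2Dsin2 t.
have : cos (t + t *+ 2) = 0.
  by rewrite -[RHS](@cos_pihalf R); congr cos; rewrite /t; lra.
rewrite cosD cos_mulr2n sin_mulr2n => E.
have c2 : cos t ^+ 2 = 3 / 4.
  have : cos t * (4 * cos t ^+ 2 - 3) = 0.
    rewrite -[RHS]E; have -> : sin t * ((cos t * sin t) *+ 2) = cos t * (2 * sin t ^+ 2) by ring.
    have -> : sin t ^+ 2 = 1 - cos t ^+ 2 by lra.
    ring.
  by move/eqP; rewrite mulf_eq0 gt_eqF //= => /eqP; lra.
have h12 : 0 <= 1 / 2 :> R by lra.
split=> //; apply/eqP; rewrite -(eqrXn2 (isT : (0 < 2)%N) (ltW s0) h12).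
by apply/eqP; rewrite expr_div_n expr1n; lra.
Qed.

Lemma pi_ge3 (R : realType) : (3 : R) <= pi.
Proof.
have [_ _ s] := cos_sin_pi6 R; have pi0 := pi_gt0 R.
have := @sin_le_id R (pi / 6); rewrite s divr_gt0 // => /(_ isT); lra.
Qed.

(** The inequality [t <= tan t] at [t = pi / 6], squared. *)
Lemma pi_sqr_le12 (R : realType) : (pi : R) ^+ 2 <= 12.
Proof.
have [c0 c2 s] := cos_sin_pi6 R; have pi0 := pi_gt0 R.
have := @mul_cos_le_sin R (pi / 6); rewrite s => /(_ _) h.
have {}h : pi / 6 * cos (pi / 6) <= 1 / 2 :> R by apply: h; apply/andP; split; lra.
have : (pi / 6 * cos (pi / 6)) ^+ 2 <= (1 / 2 : R) ^+ 2.
  by rewrite lerXn2r ?nnegrE // mulr_ge0 ?(ltW c0) // divr_ge0 ?(ltW pi0).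
rewrite exprMn c2 !expr_div_n expr1n; lra.
Qed.

(** * Bounds for [e] and for the logarithm *)

Lemma sqr_bound (R : realFieldType) (x a b : R) : 0 <= a -> a <= x -> b <= a ^+ 2 -> b <= x ^+ 2.
Proof. by move=> a0 ax ba; rewrite (le_trans ba) // lerXn2r ?nnegrE // (le_trans a0). Qed.

Lemma expR_root (R : realType) (x : R) (n : nat) : (0 < n)%N -> expR x = expR (x / n%:R) ^+ n.
Proof. by move=> n0; rewrite -expRM_natr divfK // pnatr_eq0 -lt0n. Qed.

(** [e >= (1 + 1/64)^64], computed by six squarings, each rounded down to six decimals. *)
Lemma e_ge (R : realType) : 8 / 3 <= e :> R.
Proof.
rewrite /e (@expR_root _ 1 64) //.
have h0 : 65 / 64 <= expR (1 / 64) :> R by have := expR_ge1Dx (1 / 64 : R); lra.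
rewrite (exprM _ 2 32) (exprM _ 2 16) (exprM _ 2 8) (exprM _ 2 4) (exprM _ 2 2).
move: (expR _) h0 => x0 h0.
have {h0}h1 : 1031 / 1000 + 494 / (1000 * 1000) <= x0 ^+ 2 by apply: sqr_bound h0 _; lra.
move: (x0 ^+ 2) h1 => x1 h1.
have {h1}h2 : 1063 / 1000 + 979 / (1000 * 1000) <= x1 ^+ 2 by apply: sqr_bound h1 _; lra.
move: (x1 ^+ 2) h2 => x2 h2.
have {h2}h3 : 1132 / 1000 + 51 / (1000 * 1000) <= x2 ^+ 2 by apply: sqr_bound h2 _; lra.
move: (x2 ^+ 2) h3 => x3 h3.
have {h3}h4 : 1281 / 1000 + 539 / (1000 * 1000) <= x3 ^+ 2 by apply: sqr_bound h3 _; lra.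
move: (x3 ^+ 2) h4 => x4 h4.
have {h4}h5 : 1642 / 1000 + 342 / (1000 * 1000) <= x4 ^+ 2 by apply: sqr_bound h4 _; lra.
move: (x4 ^+ 2) h5 => x5 h5.
have {h5}h6 : 2697 / 1000 + 287 / (1000 * 1000) <= x5 ^+ 2 by apply: sqr_bound h5 _; lra.
move: (x5 ^+ 2) h6 => x6 h6.
lra.
Qed.

(** [1/e >= (1 - 1/128)^128], computed by seven squarings, each rounded down to six decimals. *)
Lemma e_le (R : realType) : e <= 273 / 100 :> R.
Proof.
have e0 : 0 < e :> R by exact: expR_gt0.
suff : 366 / 1000 + 423 / (1000 * 1000) <= e^-1 :> R.
  move=> h; have := ler_wpM2r (ltW e0) h; rewrite mulVf ?gt_eqF //; lra.
rewrite /e -expRN (@expR_root _ (- 1) 128) //.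
have h0 : 127 / 128 <= expR (- 1 / 128) :> R by have := expR_ge1Dx (- 1 / 128 : R); lra.
rewrite (exprM _ 2 64) (exprM _ 2 32) (exprM _ 2 16) (exprM _ 2 8) (exprM _ 2 4) (exprM _ 2 2).
move: (expR _) h0 => x0 h0.
have {h0}h1 : 984 / 1000 + 436 / (1000 * 1000) <= x0 ^+ 2 by apply: sqr_bound h0 _; lra.
move: (x0 ^+ 2) h1 => x1 h1.
have {h1}h2 : 969 / 1000 + 114 / (1000 * 1000) <= x1 ^+ 2 by apply: sqr_bound h1 _; lra.
move: (x1 ^+ 2) h2 => x2 h2.
have {h2}h3 : 939 / 1000 + 181 / (1000 * 1000) <= x2 ^+ 2 by apply: sqr_bound h2 _; lra.
move: (x2 ^+ 2) h3 => x3 h3.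
have {h3}h4 : 882 / 1000 + 60 / (1000 * 1000) <= x3 ^+ 2 by apply: sqr_bound h3 _; lra.
move: (x3 ^+ 2) h4 => x4 h4.
have {h4}h5 : 778 / 1000 + 29 / (1000 * 1000) <= x4 ^+ 2 by apply: sqr_bound h4 _; lra.
move: (x4 ^+ 2) h5 => x5 h5.
have {h5}h6 : 605 / 1000 + 329 / (1000 * 1000) <= x5 ^+ 2 by apply: sqr_bound h5 _; lra.
move: (x5 ^+ 2) h6 => x6 h6.
have {h6}h7 : 366 / 1000 + 423 / (1000 * 1000) <= x6 ^+ 2 by apply: sqr_bound h6 _; lra.
move: (x6 ^+ 2) h7 => x7 h7.
lra.
Qed.

Lemma ln_10p7_ge16 (R : realType) (x : R) : 10 ^+ 7 <= x -> 16 <= ln x.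
Proof.
move=> hx; have x0 : 0 < x by apply: lt_le_trans hx; rewrite exprn_gt0.
rewrite -ler_expR lnK ?posrE //; apply: le_trans hx.
rewrite (@expR_root _ 16 16) // divff ?pnatr_eq0 // -/(@e R).
have e0 : 0 < e :> R by exact: expR_gt0.
have h0 := e_le R; move: (@e R) e0 h0 => y y0 h0.
have sqr_le (t a b : R) : 0 <= t -> t <= a -> a ^+ 2 <= b -> t ^+ 2 <= b.
  by move=> t0 ta; apply: le_trans; rewrite lerXn2r ?nnegrE // (le_trans t0).
rewrite (exprM _ 2 8) (exprM _ 2 4) (exprM _ 2 2).
have {}h0 : y ^+ 2 <= 7453 / 1000 by apply: sqr_le (ltW y0) h0 _; lra.
have {}h0 : (y ^+ 2) ^+ 2 <= 5555 / 100 by apply: sqr_le (sqr_ge0 _) h0 _; lra.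
have {}h0 : ((y ^+ 2) ^+ 2) ^+ 2 <= 3086 by apply: sqr_le (sqr_ge0 _) h0 _; lra.
by apply: sqr_le (sqr_ge0 _) h0 _; lra.
Qed.

(** * Comparison of the upper and lower estimates *)

Lemma exprn_le_fact (R : realType) (r : nat) : (r%:R : R) ^+ r <= e ^+ r * r`!%:R.
Proof.
elim: r => [|r IHr]; first by rewrite !expr0 mul1r.
have [->|r0] := posnP r; first by rewrite !expr1 mulr1 (le_trans _ (e_ge R)) //; lra.
have rp : 0 < (r%:R : R) by rewrite ltr0n.
have step : (r.+1%:R : R) ^+ r <= e * r%:R ^+ r.
  have -> : (r.+1%:R : R) = (1 + r%:R^-1) * r%:R.
    by rewrite mulrDl mul1r mulVf ?gt_eqF // -natr1 addrC.
  rewrite exprMn ler_wpM2r ?exprn_ge0 ?(ltW rp) //.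
  have q0 : 0 <= 1 + (r%:R : R)^-1 by rewrite addr_ge0 // invr_ge0 ltW.
  rewrite /e (@expR_root _ 1 r) // div1r.
  by rewrite lerXn2r ?nnegrE ?expR_ge0 // expR_ge1Dx.
rewrite exprS factS natrM mulrCA ler_wpM2l // exprS -mulrA.
by apply: le_trans step _; rewrite ler_wpM2l // ltW ?expR_gt0.
Qed.

(** For [Y = sqrt p], the degenerate pairs cost no more than [h^(2 r) sqrt p] with [h = 21 r]. By
    [C(h, r) <= h^r / r!] and [r^r <= e^r r!], it suffices that [e^r Y <= 21^r]; the constant 21 is
    chosen so that [e^3 < 21]. *)
Lemma degenerate_term_bound (R : realType) (r : nat) (Y : R) :
  0 <= Y -> Y <= e ^+ (2 * r) ->
  ('C(21 * r, r) * r ^ (2 * r))%:R * Y ^+ 2 <= (((21 * r)%:R : R) ^+ r) ^+ 2 * Y.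
Proof.
move=> Y0 Ye; have e0 : 0 <= e :> R by exact: expR_ge0.
have ffact_le n m : (n ^_ m <= n ^ m)%N.
  elim: m n => [|m IHm] n //; rewrite ffactnS expnS leq_mul2l; apply/orP; right.
  by apply: leq_trans (IHm _) _; case: (m) => // k; rewrite leq_exp2r // leq_pred.
have Ch : ('C(21 * r, r)%:R : R) * r`!%:R <= (21 * r)%:R ^+ r.
  by rewrite -natrM bin_ffact -natrX ler_nat.
have h1 : ('C(21 * r, r) * r ^ (2 * r))%:R <= (21 * r)%:R ^+ r * (e ^+ r * r%:R ^+ r) :> R.
  rewrite natrM natrX (mulnC 2 r) exprM expr2.
  apply: (@le_trans _ _ ('C(21 * r, r)%:R * ((e ^+ r * r`!%:R) * r%:R ^+ r))).
    by rewrite ler_wpM2l // ler_wpM2r ?exprn_ge0 // exprn_le_fact.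
  have -> (c f x y : R) : c * (x * f * y) = c * f * (x * y) by ring.
  by rewrite ler_wpM2r // mulr_ge0 ?exprn_ge0.
have e3 : e ^+ r * Y <= 21 ^+ r.
  apply: (@le_trans _ _ ((e ^+ 3) ^+ r)).
    have e3r : (3 * r = r + 2 * r)%N by lia.
    by rewrite -exprM e3r exprD ler_wpM2l ?exprn_ge0.
  rewrite lerXn2r ?nnegrE ?exprn_ge0 //; have := e_le R; move: (@e R) e0 => y y0 h.
  apply: (@le_trans _ _ ((11 / 4) ^+ 3)); last by clear; lra.
  by rewrite lerXn2r ?nnegrE //; move: h; clear; lra.
apply: le_trans (ler_wpM2r (sqr_ge0 _) h1) _.
have eA : ((21 * r)%:R : R) ^+ r = 21 ^+ r * r%:R ^+ r by rewrite natrM exprMn.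
have r0 : 0 <= (r%:R : R) ^+ r by rewrite exprn_ge0.
rewrite [X in _ <= X ^+ 2 * _]eA.
have -> : (21 * r)%:R ^+ r * (e ^+ r * r%:R ^+ r) * Y ^+ 2 =
    (21 * r)%:R ^+ r * r%:R ^+ r * Y * (e ^+ r * Y) by ring.
have -> : (21 ^+ r * r%:R ^+ r) ^+ 2 * Y = (21 * r)%:R ^+ r * r%:R ^+ r * Y * 21 ^+ r.
  by rewrite eA; ring.
by rewrite ler_wpM2l // !mulr_ge0 // exprn_ge0.
Qed.

(** Here [z] is [p^(1/8)] and [G] the number of almost constant points. The last hypothesis gives
    [(19/21)^2 G <= 3/2 L z^4], hence [(19/21)^2 42 r G < 20 L^2 z^4], while the bounds on [H] force
    the same quantity above [24 L^2 z^4]. *)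
Lemma lower_upper_incompatible (R : realFieldType) (L z r G H : R) :
  16 <= L -> 7 <= z -> 0 <= r <= 5 / 16 * L -> 28 / 5 * z ^+ 2 * L < H ->
  H ^+ 2 <= 42 * r * (G + H) ->
  G * (19 / 21) ^+ 2 <= z ^+ 4 + (4 * r + 2) * z ^+ 4 + 2 * r -> False.
Proof.
move=> L16 z7 /andP[r0 rL] xH HG GY.
have L0 : 0 <= L by lra.
have z2 : 49 <= z ^+ 2.
  apply: (@le_trans _ _ (7 ^+ 2)); first by clear; lra.
  by rewrite lerXn2r ?nnegrE //; lra.
move: GY; rewrite (exprM z 2 2); move: (z ^+ 2) z2 xH => Z Z0 {z7}xH GY.
pose x := 28 / 5 * Z * L; rewrite -/x in xH.
have LZ : 49 * L <= Z * L by rewrite ler_wpM2r.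
have rx : 42 * r <= 1 / 20 * x by rewrite /x; move: rL LZ L0; clear; lra.
have x0 : 0 <= x by rewrite /x !mulr_ge0 //; move: Z0; clear; lra.
have h1 : 19 / 20 * x ^+ 2 <= 42 * r * G.
  apply: (@le_trans _ _ (x * (x - 42 * r))).
    have := ler_wpM2l x0 rx; clear; lra.
  have : x * (x - 42 * r) <= H * (H - 42 * r).
    by apply: ler_pM => //; move: xH rx x0; clear; lra.
  by move: HG; clear; lra.
have Y0 : 2400 <= Z ^+ 2.
  apply: (@le_trans _ _ (49 ^+ 2)); first by clear; lra.
  by rewrite lerXn2r ?nnegrE //; move: Z0; clear; lra.
have ex : 31 * (Z ^+ 2 * L ^+ 2) <= x ^+ 2.
  have -> : x ^+ 2 = (28 / 5) ^+ 2 * (Z ^+ 2 * L ^+ 2) by rewrite /x; field.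
  by apply: ler_wpM2r; [rewrite mulr_ge0 ?sqr_ge0|clear; lra].
move: (Z ^+ 2) (x ^+ 2) Y0 ex GY h1 => Y X Y0 ex GY h1.
have Y1 : 0 <= Y by move: Y0; clear; lra.
have GY' : G * (19 / 21) ^+ 2 <= 3 / 2 * (L * Y).
  apply: le_trans GY _.
  have a1 : r * Y <= 5 / 16 * L * Y by rewrite ler_wpM2r.
  have a2 : 16 * Y <= L * Y by rewrite ler_wpM2r.
  have a3 : L * 50 <= L * Y by rewrite ler_wpM2l //; move: Y0; clear; lra.
  move: a1 a2 a3 rL L0; clear; lra.
have h2 : 42 * r * (G * (19 / 21) ^+ 2) <= 42 * (5 / 16 * L) * (3 / 2 * (L * Y)).
  apply: (@le_trans _ _ (42 * r * (3 / 2 * (L * Y)))).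
    by rewrite ler_wpM2l // mulr_ge0.
  by rewrite ler_wpM2r ?ler_wpM2l // !mulr_ge0.
have LY : 0 < Y * L ^+ 2.
  by rewrite mulr_gt0 ?exprn_gt0 //; [move: Y0; clear; lra|move: L16; clear; lra].
have := le_trans (ler_wpM2l (_ : 0 <= 19 / 20) ex) h1; move: h2 LY; clear => h2 LY h3.
have {}h3 := h3 ltac:(lra); lra.
Qed.

(** Fixes the parameters. With [z = p^(1/8)], the bounds [L <= 8 (z - 1)] and [z >= 7] make the size
    conditions polynomial in [z]. *)
Lemma long_residue_interval_false (R : realType) (p l s u H0 : nat) :
  prime p -> prime l -> p = (l * s).+1 -> prime u -> 16 <= ln (p%:R : R) ->
  e ^+ 2 * ln (p%:R : R) <= u%:R ->
  (forall v : nat, (0 < v <= H0)%N -> ~~ (u %| v)%N -> (v%:R : 'F_p) ^+ s = 1) ->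
  28 / 5 * expR (ln (p%:R : R) / 4) * ln (p%:R : R) < H0%:R -> False.
Proof.
move=> p_pr l_pr ep u_pr L16 Lu res xH0.
have p0 : 0 < (p%:R : R) by rewrite ltr0n prime_gt0.
have expL : expR (ln (p%:R : R)) = p%:R by rewrite lnK // posrE.
move: (ln (p%:R : R)) L16 Lu xH0 expL => L L16 Lu xH0 expL.
pose z := expR (L / 8).
have z0 : 0 < z by exact: expR_gt0.
have ez : expR (L / 4) = z ^+ 2 by rewrite /z -expRM_natl; congr expR; lra.
have zp : z ^+ 8 = p%:R by rewrite -expL /z -expRM_natl; congr expR; lra.
have Lz : L <= 8 * (z - 1) by have := expR_ge1Dx (L / 8); rewrite -/z; lra.
have ee := e_ge R.
have e0 : 0 <= e :> R by lra.
have z7 : 7 <= z.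
  apply: (@le_trans _ _ (e ^+ 2)).
    apply: (@le_trans _ _ ((8 / 3) ^+ 2)); first by clear; lra.
    by apply: sqr_bound ee _ => //; clear; lra.
  by rewrite /e -expRM_natl ler_expR; move: L16; clear; lra.
rewrite ez in xH0.
pose x := 28 / 5 * z ^+ 2 * L; rewrite -/x in xH0.
have x0 : 0 <= x by rewrite /x !mulr_ge0 ?exprn_ge0 ?(ltW z0) //; lra.
have /andP[Hx xH] := truncn_itv x0.
(* The interval is shortened to the least integer above [x], because the counting of fractions needs
   [H < p] and [2 H^2 < k p]. *)
pose H := (Num.truncn x).+1.
have HH0 : (H <= H0)%N by rewrite /H -(ltr_nat R) (le_lt_trans Hx).
have Hx1 : (H%:R : R) <= x + 1 by rewrite /H -natr1 lerD2r.
have L4 : 0 <= L / 4 by lra.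
have /andP[rl rh] := truncn_itv L4.
(* [r > L / 4] ensures [sqrt p = e^(L/2) <= e^(2 r)], as [degenerate_term_bound] asks. *)
pose r := (Num.truncn (L / 4)).+1.
have r_lo : L / 4 < r%:R := rh.
have r_hi : (r%:R : R) <= L / 4 + 1 by rewrite /r -natr1 lerD2r.
have Y0 : 0 <= z ^+ 4 by rewrite exprn_ge0 ?ltW.
have /andP[nY Yn] := truncn_itv Y0.
pose n := Num.truncn (z ^+ 4); rewrite -/n in nY Yn.
have r_gt0 : (0 < r)%N by [].
have z2 : 49 <= z ^+ 2 by apply: sqr_bound z7 _; clear; lra.
have z4 : 2400 <= z ^+ 4.
  by rewrite (exprM z 2 2); apply: sqr_bound z2 _; clear; lra.
have zY : z ^+ 8 = (z ^+ 4) ^+ 2 by rewrite -exprM.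
(* Strict on the left because a prime is not a square. *)
have np : (n ^ 2 < p < n.+1 ^ 2)%N.
  apply/andP; split.
    rewrite ltn_neqAle; apply/andP; split; last first.
      by rewrite -(ler_nat R) natrX -zp zY lerXn2r ?nnegrE.
    apply/eqP => en; have np1 : n != 1%N by apply: contraTneq p_pr => n1; rewrite -en n1.
    have /primeP[_ /(_ n)] := p_pr; rewrite -{1}en dvdn_exp // (negPf np1) /= => /(_ isT)/eqP np.
    by move: en; rewrite np expnS expn1; have := prime_gt1 p_pr; clear; nia.
  by rewrite -(ltr_nat R) natrX -zp zY ltrXn2r ?nnegrE // ltW.
have rz : (r%:R : R) <= 2 * z - 1 by move: r_hi Lz; clear; lra.
have r0 : 0 <= (r%:R : R) by [].
have zz1 : 49 * z ^+ 2 <= z ^+ 4 by rewrite (exprM z 2 2) expr2 ler_wpM2r // sqr_ge0.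
have zz2 : 7 * z <= z ^+ 2 by rewrite expr2 ler_wpM2r // ltW.
have rsq : (r%:R : R) ^+ 2 <= (2 * z - 1) ^+ 2.
  by rewrite lerXn2r ?nnegrE // (le_trans r0).
have rn : (2 * (r ^ 2 + 6 * r + 3) <= n)%N.
  rewrite -ltnS -(ltr_nat R); apply: le_lt_trans Yn.
  rewrite natrM !natrD natrX natrM.
  move: rsq rz zz1 zz2 z7 z4; clear; lra.
have zp8 : 2400 * z ^+ 4 <= p%:R by rewrite -zp zY [leRHS]expr2 ler_wpM2r.
pose k := (21 * r).-1.
have ek : k.+1 = (21 * r)%N by rewrite /k prednK // muln_gt0.
have kR : (k%:R : R) = 21 * r%:R - 1.
  by apply: (addIr 1); rewrite subrK natr1 ek natrM.
have hp : (21 * r <= p)%N.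
  rewrite -(ler_nat R) natrM; apply: le_trans zp8.
  move: rz zz1 zz2 z7; clear; lra.
have k_gt0 : (0 < k)%N by rewrite -ltnS ek; move: r_gt0; clear; lia.
(* The lower bound on [u] enters here: [21 r <= 21/4 L + 21 <= 7 L <= e^2 L <= u]. *)
have ku : (k < u)%N.
  rewrite ek -(ler_nat R) natrM; apply: le_trans Lu.
  apply: (@le_trans _ _ (7 * L)); first by move: r_hi L16; clear; lra.
  by rewrite ler_wpM2r ?(le_trans _ L16) //; apply: sqr_bound ee _; clear; lra.
have L0 : 0 <= L by move: L16; clear; lra.
have xz3 : x + 1 <= 29 / 5 * z ^+ 2 * L.
  have : 49 * 16 <= z ^+ 2 * L by apply: ler_pM.
  by rewrite /x; clear; lra.
have HL : (H%:R : R) <= 29 / 5 * z ^+ 2 * L := le_trans Hx1 xz3.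
have z2L : z ^+ 2 * L <= 8 * z ^+ 3.
  rewrite [z ^+ 3]exprSr mulrCA ler_wpM2l ?sqr_ge0 //; move: Lz; clear; lra.
have HltP : (H < p)%N.
  rewrite -(ltr_nat R); apply: le_lt_trans HL _; apply: lt_le_trans zp8.
  have : z ^+ 3 <= z ^+ 4 by rewrite [leRHS]exprSr ler_peMr ?exprn_ge0 ?(ltW z0) //; move: z7; clear; lra.
  move: z2L z4; clear; lra.
have Hp : (2 * H ^ 2 < k * p)%N.
  rewrite -(ltr_nat R) (natrM _ 2) (natrM _ k) (natrX _ H 2) kR -zp.
  apply: (@lt_le_trans _ _ (5 * L * z ^+ 8)); last first.
    by rewrite ler_wpM2r ?exprn_ge0 ?(ltW z0) //; move: r_lo L16; clear; lra.
  have z40 : 0 < z ^+ 4 by rewrite exprn_gt0.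
  have Lp : 0 < L by move: L16; clear; lra.
  apply: (@le_lt_trans _ _ (2 * (29 / 5 * z ^+ 2 * L) ^+ 2)).
    by rewrite ler_wpM2l // lerXn2r ?nnegrE // (le_trans _ HL).
  have -> : 2 * (29 / 5 * z ^+ 2 * L) ^+ 2 = 2 * (29 / 5) ^+ 2 * L * (L * z ^+ 4) by ring.
  have -> : 5 * L * z ^+ 8 = 5 * z ^+ 4 * (L * z ^+ 4) by ring.
  rewrite ltr_pM2r ?mulr_gt0 //; move: Lz zz1 zz2 z7; clear; lra.
have s_gt0 : (0 < s)%N by case: (s) ep p_pr => // ->; rewrite muln0.
have res' (v : nat) : (0 < v <= H)%N -> ~~ (u %| v)%N -> (v%:R : 'F_p) ^+ s = 1.
  by case/andP=> v0 vH; apply: res; rewrite v0 (leq_trans vH).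
have upper := card_almost_constant_points R p_pr l_pr ep r_gt0 np rn (leqnn (21 * r)) hp.
have lower := card_almost_constant_ge p_pr s_gt0 k_gt0 u_pr ku Hp HltP res'.
have tri := card_coprime_triangle H k_gt0.
rewrite ek in lower.
apply: (@lower_upper_incompatible R L z r%:R #|almost_constant_points p s (21 * r)|%:R H%:R) => //.
- by rewrite r0 /=; move: r_hi L16; clear; lra.
- have : (H ^ 2 <= 2 * k * (#|almost_constant_points p s (21 * r)| + H))%N.
    by move: tri (leq_mul (leqnn (2 * k)) lower); clear; lia.
  rewrite -(ler_nat R) natrX !natrM natrD kR => /le_trans; apply.
  by rewrite ler_wpM2r ?addr_ge0 //; move: r0; clear; lra.
have hr0 : 0 < (((21 * r)%:R : R) ^+ r) ^+ 2 by rewrite !exprn_gt0 // ltr0n muln_gt0.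
have Ye : z ^+ 4 <= e ^+ (2 * r).
  rewrite /z /e -!expRM_natl ler_expR natrM; move: r_lo; clear; lra.
have deg := degenerate_term_bound Y0 Ye; rewrite -zY zp in deg.
have {}upper := le_trans upper (lerD deg (lexx _)).
rewrite -(ler_pM2l hr0); apply: le_trans (le_trans _ upper) _.
  by rewrite mulrC.
rewrite -mulrDr ler_wpM2l ?(ltW hr0) // -addrA lerD2l natrD !natrM natrD natrM lerD2r.
have -> : 2 * (2 * r%:R + 1%:R) * n%:R = (4 * r%:R + 2) * n%:R :> R by ring.
by rewrite ler_wpM2l // addr_ge0 // mulr_ge0.
Qed.

(** * The function g *)

Definition g_arg (R : realType) (x : R) : R := K * x `^ (1 / 4) / (2 * e ^+ 2).

Lemma ln_leB1 (R : realType) (x : R) : 0 < x -> ln x <= x - 1.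
Proof. by move=> x0; have := @le_ln1Dx R (x - 1); rewrite addrCA subrr addr0; apply; lra. Qed.

Lemma inv_1m89_ge0 (R : realType) : 0 <= 1 / (1 - 89^-1) :> R.
Proof. by rewrite div1r invr_ge0 subr_ge0 invf_le1 //; lra. Qed.

Lemma f_le1 (R : realType) (X : R) : 1 <= X -> f X 89 <= 1.
Proof.
move=> X1; rewrite /f lerBlDr lerDl; have X0 : 0 <= X by lra.
have l0 : 0 <= ln X by rewrite ln_ge0.
have c0 := inv_1m89_ge0 R.
rewrite mulr_ge0 ?(divr_ge0 (sqr_ge0 _)) // addr_ge0 //; last by rewrite mulr_ge0 // divr_ge0 // addr_ge0.
by rewrite addr_ge0 // divr_ge0 // mulr_ge0 // sqr_ge0.
Qed.

(** Each subtracted term decreases for [X >= 1]. For [(1 + ln X) / X] this follows from the tangent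
    bound [ln Y <= ln X + Y / X - 1] and [ln X >= 0]. *)
Lemma f_homo (R : realType) (X Y : R) : 1 <= X -> X <= Y -> f X 89 <= f Y 89.
Proof.
move=> X1 XY; have X0 : 0 < X by lra. have Y0 : 0 < Y by lra.
rewrite /f lerD2l lerN2 ler_wpM2l ?divr_ge0 ?sqr_ge0 //.
rewrite !lerD //.
- by rewrite !div1r lef_pV2 ?posrE ?mulr_gt0 ?exprn_gt0 // ler_wpM2l // lerXn2r ?nnegrE ?(ltW X0) ?(ltW Y0).
- by rewrite !div1r lef_pV2 ?posrE ?mulr_gt0 // ler_wpM2l.
rewrite ler_wpM2l //.
  exact: inv_1m89_ge0.
rewrite ler_pdivrMr // mulrAC ler_pdivlMr //.
have h : ln Y <= ln X + (Y / X - 1).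
  have := ln_leB1 (divr_gt0 Y0 X0); rewrite ln_div ?posrE //; lra.
have l0 := ln_ge0 X1.
have h2 : X * ln Y <= X * ln X + Y - X.
  have := ler_wpM2l (ltW X0) h; rewrite mulrDr mulrBr mulrCA divff ?gt_eqF // !mulr1; lra.
have := ler_wpM2r l0 XY; lra.
Qed.

(** For [x >= 10^7] the argument of [f] in [g] is at least 21, so by monotonicity this value settles
    the sign. The logarithm is bounded by its tangent at [e^3], and [pi^2 / 3] by 4. *)
Lemma f_21_gt0 (R : realType) : 0 < f (21 : R) 89.
Proof.
have e0 : 0 < e :> R by exact: expR_gt0.
have l21 : ln (21 : R) <= 311 / 100.
  have := @ln_leB1 R (21 / e ^+ 3); rewrite divr_gt0 ?exprn_gt0 // => /(_ isT).
  rewrite ln_div ?posrE ?exprn_gt0 // lnXn // /e expRK -/(@e R).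
  have : 21 / e ^+ 3 <= 111 / 100 :> R.
    rewrite ler_pdivrMr ?exprn_gt0 //.
    apply: (@le_trans _ _ (111 / 100 * (8 / 3) ^+ 3)); first by clear; lra.
    have : (8 / 3) ^+ 3 <= e ^+ 3 :> R by rewrite lerXn2r ?nnegrE ?e_ge ?(ltW e0) // divr_ge0.
    by move: (_ ^+ 3) (_ ^+ 3); clear => a b; lra.
  by move: (21 / _) => t; lra.
have pi12 := pi_sqr_le12 R.
rewrite /f subr_gt0.
have -> : 1 / (2 * 21 ^+ 2) + 1 / (2 * 21) + 1 / (1 - 89^-1) * ((1 + ln 21) / 21) =
    22 / 21 / 42 + 89 / 88 / 21 * (1 + ln 21) :> R by field.
have l0 := @ln_ge0 R 21; move: (ln 21) l0 l21 => t /(_ ltac:(lra)) t0 t1.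
apply: (@le_lt_trans _ _ (4 * (22 / 21 / 42 + 89 / 88 / 21 * (1 + t)))).
  by rewrite ler_wpM2r //; [move: t0; clear; lra|move: pi12; clear; lra].
by move: t1; clear; lra.
Qed.

Lemma K_lower (R : realType) : 21 / 10 * e <= K :> R.
Proof.
have s0 : 0 < Num.sqrt 2 :> R by rewrite sqrtr_gt0.
have s2 : Num.sqrt 2 <= 10 / 7 :> R.
  by rewrite -(@ler_pXn2r _ 2) ?nnegrE ?(ltW s0) // ?divr_ge0 // sqr_sqrtr //; clear; lra.
have e0 : 0 < e :> R by exact: expR_gt0.
rewrite /K ler_pdivlMr // mulrAC [pi * _]mulrC.
rewrite -[leRHS]mulrC ler_wpM2r ?(ltW e0) //; apply: le_trans (pi_ge3 R).
by move: s2; clear; lra.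
Qed.

(** [28/5 = 21/10 * 8/3], the product of the lower bounds for [pi / sqrt 2] and [e]. *)
Lemma K_ge (R : realType) : 28 / 5 <= K :> R.
Proof. by have := K_lower R; have := e_ge R; move: (@e R) (@K R); clear => *; lra. Qed.

Definition g_den (R : realType) (x : R) : R := (1 - 1 / (e ^+ 2 * ln x)) * f (g_arg x) 89.
Definition g_num (R : realType) (x : R) : R := 1 + 4 / (3 * ln x).

Section GProperties.
Variable (R : realType).
Implicit Types x y : R.

Let e_gt0 : 0 < e :> R. Proof. exact: expR_gt0. Qed.
Let K_gt0 : 0 < K :> R. Proof. by apply: lt_le_trans (K_ge R); lra. Qed.
Let big_gt0 x : 10 ^+ 7 <= x -> 0 < x.
Proof. by apply: lt_le_trans; rewrite exprn_gt0. Qed.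

Lemma g_arg_homo x y : 0 <= x -> x <= y -> g_arg x <= g_arg y.
Proof.
move=> x0 xy; rewrite /g_arg ler_pM2r ?invr_gt0 ?mulr_gt0 ?exprn_gt0 // ler_pM2l //.
by rewrite ge0_ler_powR ?nnegrE ?divr_ge0 // (le_trans x0).
Qed.

Lemma powR4K x : 0 < x -> (x `^ (1 / 4)) ^+ 4 = x.
Proof.
move=> x0; have e4 : 1 / 4 * 4%:R = 1 :> R by rewrite div1r mulVf.
by rewrite -powR_mulrn ?powR_ge0 // -powRrM e4 powRr1 // ltW.
Qed.

Lemma g_arg_ge21 x : 10 ^+ 7 <= x -> 21 <= g_arg x.
Proof.
move=> hx; have x0 := big_gt0 hx.
(* [56^4 = 9834496]. *)
have y56 : 56 <= x `^ (1 / 4).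
  rewrite -(@ler_pXn2r _ 4) ?nnegrE ?powR_ge0 // powR4K //.
  by apply: le_trans hx; lra.
rewrite /g_arg ler_pdivlMr ?mulr_gt0 ?exprn_gt0 //.
apply: (@le_trans _ _ (21 / 10 * e * 56)); last first.
  by apply: ler_pM (K_lower R) y56; rewrite ?mulr_ge0 ?(ltW e_gt0) //; lra.
have e0 := e_gt0; have := ler_wpM2l (ltW e0) (e_le R); lra.
Qed.

Lemma g_num_gt1 x : 10 ^+ 7 <= x -> 1 < g_num x.
Proof.
move=> hx; have L16 := ln_10p7_ge16 hx; rewrite ltrDl divr_gt0 // mulr_gt0 //; lra.
Qed.

Lemma eln_gt1 x : 10 ^+ 7 <= x -> 1 < e ^+ 2 * ln x.
Proof.
move=> hx; have L16 := ln_10p7_ge16 hx.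
have e2 : 1 <= e ^+ 2 :> R by rewrite exprn_ege1 //; apply: le_trans (e_ge R); lra.
by have := ler_pM _ _ e2 L16; move=> /(_ ltac:(lra) ltac:(lra)); lra.
Qed.

Lemma g_den_gt0 x : 10 ^+ 7 <= x -> 0 < g_den x.
Proof.
move=> hx; rewrite mulr_gt0 //.
  by rewrite subr_gt0 div1r invf_lt1 ?eln_gt1 // (lt_trans _ (eln_gt1 hx)).
by apply: lt_le_trans (f_21_gt0 R) _; rewrite f_homo ?g_arg_ge21 //; lra.
Qed.

Lemma g_den_le1 x : 10 ^+ 7 <= x -> g_den x <= 1.
Proof.
move=> hx; have X21 := g_arg_ge21 hx; rewrite -[leRHS]mulr1; apply: ler_pM.
- by rewrite subr_ge0 div1r invf_le1 ?ltW ?eln_gt1 // (lt_trans _ (eln_gt1 hx)).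
- by apply: ltW; apply: lt_le_trans (f_21_gt0 R) _; rewrite f_homo //; lra.
- by rewrite gerBl div1r invr_ge0 ltW // (lt_trans _ (eln_gt1 hx)).
- by rewrite f_le1 //; lra.
Qed.

Lemma g_den_homo x y : 10 ^+ 7 <= x -> x <= y -> g_den x <= g_den y.
Proof.
move=> hx xy; have hy := le_trans hx xy; have X21 := g_arg_ge21 hx.
have x0 := big_gt0 hx; have L16 := ln_10p7_ge16 hx.
apply: ler_pM.
- by rewrite subr_ge0 div1r invf_le1 ?ltW ?eln_gt1 // (lt_trans _ (eln_gt1 hx)).
- by apply: ltW; apply: lt_le_trans (f_21_gt0 R) _; rewrite f_homo //; lra.
- rewrite lerD2l lerN2 !div1r lef_pV2 ?posrE ?(lt_trans _ (eln_gt1 hx)) ?(lt_trans _ (eln_gt1 hy)) //.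
  by rewrite ler_pM2l ?exprn_gt0 // ler_ln ?posrE // (lt_le_trans x0).
- by rewrite f_homo ?g_arg_homo ?(ltW x0) //; lra.
Qed.

Lemma g_ge1 x : 10 ^+ 7 <= x -> 1 <= g x.
Proof.
move=> hx; rewrite -[leLHS]sqrtr1; apply: ler_wsqrtr; rewrite -/(g_arg x) -/(g_den x) -/(g_num x).
by rewrite ler_pdivlMr ?g_den_gt0 // mul1r (le_trans (g_den_le1 hx)) // ltW // g_num_gt1.
Qed.

(** Strictness comes from the numerator; the denominator is nondecreasing. *)
Lemma g_decreasing x y : 10 ^+ 7 <= x -> x < y -> g y < g x.
Proof.
move=> hx xy; have hy := le_trans hx (ltW xy).
have x0 := big_gt0 hx; have y0 := big_gt0 hy.
have Lx := ln_10p7_ge16 hx; have Ly := ln_10p7_ge16 hy.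
rewrite /g -/(g_arg x) -/(g_arg y) -/(g_den x) -/(g_den y) -/(g_num x) -/(g_num y).
rewrite ltr_sqrt; last by rewrite divr_gt0 ?g_den_gt0 // (lt_trans _ (g_num_gt1 hx)).
apply: (@le_lt_trans _ _ (g_num y / g_den x)).
  rewrite ler_pM2l ?(lt_trans _ (g_num_gt1 hy)) // lef_pV2 ?posrE ?g_den_gt0 //.
  by rewrite g_den_homo // ltW.
rewrite ltr_pM2r ?invr_gt0 ?g_den_gt0 // ltrD2l ltr_pM2l // ltf_pV2 ?posrE ?mulr_gt0 //; [|lra|lra].
by rewrite ltr_pM2l // ltr_ln ?posrE.
Qed.

(** * Limit of [g] at infinity *)

Local Open Scope classical_set_scope.
Local Open Scope ring_scope.

Lemma cvgy_ln : ln (x : R) @[x --> +oo] --> +oo.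
Proof.
apply/cvgryPge => A; near=> x.
have Ax : expR A <= x by near: x; exact: nbhs_pinfty_ge.
by rewrite -[A]expRK ler_ln ?posrE ?expR_gt0 // (lt_le_trans (expR_gt0 A)).
Unshelve. all: by end_near. Qed.

Lemma cvg_inv_ln : (ln x)^-1 @[x --> +oo] --> (0 : R).
Proof.
apply/(@gtr0_cvgV0 R R); last exact: cvgy_ln.
by near=> x; rewrite ln_gt0 //; near: x; exact: nbhs_pinfty_gt.
Unshelve. all: by end_near. Qed.

(** Taking a square as argument makes [ln (t^2) <= 2 (t - 1)] strong enough:
    [(1 + ln (t^2)) / t^2 <= 2 / t]. The constant 20 is rough, as only the limit is at stake. *)
Lemma f_sqr_ge (t : R) : 1 <= t -> 1 - 20 / t <= f (t ^+ 2) 89.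
Proof.
move=> t1; have t0 : 0 < t by lra.
have lnt : ln (t ^+ 2) <= 2 * (t - 1).
  by rewrite lnXn // -[_ *+ 2]mulr_natl ler_wpM2l // ln_leB1.
have -> : f (t ^+ 2) 89 = 1 - pi ^+ 2 / 3 *
    (1 / (2 * (t ^+ 2) ^+ 2) + 1 / (2 * t ^+ 2) + 89 / 88 * ((1 + ln (t ^+ 2)) / t ^+ 2)).
  by rewrite /f; congr (_ - _ * (_ + _ * _)); field.
have v0 : 0 < t^-1 by rewrite invr_gt0.
have v1 : t^-1 <= 1 by rewrite invf_le1.
have h : 1 / (2 * (t ^+ 2) ^+ 2) + 1 / (2 * t ^+ 2) + 89 / 88 * ((1 + ln (t ^+ 2)) / t ^+ 2) <= 5 / t.
  have -> : 1 / (2 * (t ^+ 2) ^+ 2) = 1 / 2 * t^-1 ^+ 4 by field; rewrite gt_eqF.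
  have -> : 1 / (2 * t ^+ 2) = 1 / 2 * t^-1 ^+ 2 by field; rewrite gt_eqF.
  have h1 : (1 + ln (t ^+ 2)) / t ^+ 2 <= 2 * t^-1.
    rewrite ler_pdivrMr ?exprn_gt0 // expr2 mulrA mulfVK ?gt_eqF //; lra.
  have h2 : t^-1 ^+ 2 <= t^-1 by rewrite expr2 ger_pMl.
  have h4 : t^-1 ^+ 4 <= t^-1 by rewrite exprS ger_pMr // exprn_ile1 // ltW.
  lra.
have := pi_sqr_le12 R; move: (pi ^+ 2) (sqr_ge0 (pi : R)) => q q0 q12.
have : q / 3 * (1 / (2 * (t ^+ 2) ^+ 2) + 1 / (2 * t ^+ 2) + 89 / 88 * ((1 + ln (t ^+ 2)) / t ^+ 2))
   <= 4 * (5 / t).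
  apply: (@le_trans _ _ (q / 3 * (5 / t))); first by rewrite ler_wpM2l // divr_ge0.
  by rewrite ler_wpM2r ?divr_ge0 ?(ltW t0) //; lra.
lra.
Qed.

(** With [w = x^(1/8) >= ln x / 8] one has [g_arg x >= (w / 2)^2], so the error [40 / w] is at most
    [320 / ln x], and the limit reduces to that of [1 / ln x]. *)
Lemma f_g_arg_ge (x : R) : 10 ^+ 7 <= x -> 1 - 320 / ln x <= f (g_arg x) 89.
Proof.
move=> hx; have L16 := ln_10p7_ge16 hx; have x0 := big_gt0 hx.
pose w := expR (ln x / 8).
have wL : ln x / 8 <= w by have := expR_ge1Dx (ln x / 8); rewrite -/w; lra.
have w2 : (w / 2) ^+ 2 <= g_arg x.
  have -> : (w / 2) ^+ 2 = 1 / 4 * expR (1 / 4 * ln x).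
    rewrite exprMn [w ^+ 2]expr2 -expRD (_ : _ + _ = 1 / 4 * ln x); [by field|lra].
  rewrite /g_arg /powR gt_eqF // [leRHS]mulrAC ler_wpM2r ?expR_ge0 //.
  rewrite ler_pdivlMr ?mulr_gt0 ?exprn_gt0 //.
  have e0 := e_gt0; have := ler_wpM2l (ltW e0) (e_le R); have := K_lower R; lra.
apply: (@le_trans _ _ (1 - 20 / (w / 2))).
  rewrite lerD2l lerN2 ler_pdivrMr; last by lra.
  rewrite mulrAC ler_pdivlMr; lra.
by apply: le_trans (f_sqr_ge _) (f_homo _ w2); [lra|rewrite exprn_ege1 //; lra].
Qed.

Lemma cvgy_g : g x @[x --> +oo] --> (1 : R).
Proof.
have cL (c : R) : c / ln x @[x --> +oo] --> (0 : R).
  by rewrite -(mulr0 c); apply: cvgM; [exact: cvg_cst|exact: cvg_inv_ln].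
have cnum : g_num x @[x --> +oo] --> (1 : R).
  rewrite -[X in _ --> X]addr0; apply: cvgD; first exact: cvg_cst.
  rewrite (_ : (fun x => _) = (fun x => 4 / 3 / ln x)); first exact: cL.
  by apply/funext => x; rewrite invfM mulrA.
have cf : f (g_arg x) 89 @[x --> +oo] --> (1 : R).
  apply: (@squeeze_cvgr _ _ _ _ (fun x => 1 - 320 / ln x) (cst 1)).
  - near=> x; have hx : 10 ^+ 7 <= x by near: x; exact: nbhs_pinfty_ge.
    by rewrite f_g_arg_ge //= f_le1 //; have := g_arg_ge21 hx; lra.
  - by rewrite -[X in _ --> X]subr0; apply: cvgB; [exact: cvg_cst|exact: cL].
  - exact: cvg_cst.
have cden : g_den x @[x --> +oo] --> (1 : R).
  rewrite -[X in _ --> X](mulr1 1); apply: cvgM => //.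
  rewrite -[X in _ --> X]subr0; apply: cvgB; first exact: cvg_cst.
  rewrite (_ : (fun x => _) = (fun x => e ^- 2 / ln x)); first exact: cL.
  by apply/funext => x; rewrite invfM mul1r.
rewrite -[X in _ --> X]sqrtr1; apply: continuous_cvg; first exact: sqrt_continuous.
rewrite -[X in _ --> X]divr1; apply: cvgM => //; apply: cvgV => //.
Unshelve. all: by end_near. Qed.

End GProperties.

(** * Deduction of the bound on [H] and of the properties of [g] *)

Local Open Scope classical_set_scope.
Local Open Scope ring_scope.

Theorem theorem2p4 (R : realType) :
  (forall (p : nat) (chi : int -> R[i]) (u H : nat),
     prime p ->
     10 ^+ 7 <= p%:R :> R ->
     dirichlet_character p chi ->
     chi <> principal_character R p ->
     prime u ->
     e ^+ 2 * ln (p%:R : R) <= u%:R ->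
     (0 < H)%N ->
     (forall n : int, 1 <= n <= H%:Z -> coprimez n u%:Z -> chi n = 1) ->
     H%:R <= (2 * e ^+ 2 * ln (p%:R : R) - 2) `^ (1 / 2) * p%:R `^ (1 / 2) ->
     H%:R <= K * g (p%:R : R) * p%:R `^ (1 / 4) * ln p%:R)
  /\ (forall x : R, 10 ^+ 7 <= x -> 0 < g x)
  /\ (forall x y : R, 10 ^+ 7 <= x -> x < y -> g y < g x)
  /\ (g x @[x --> +oo] --> (1 : R)).
Proof.
split; last first.
  split; first by move=> x hx; apply: lt_le_trans (g_ge1 hx).
  by split; [exact: g_decreasing|exact: cvgy_g].
move=> p chi u H p_pr p7 chiD nprinc u_pr Lu _ chi1 _.
have [l [s [l_pr ep ker]]] := character_kernel_residues p_pr chiD nprinc.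
have L16 := ln_10p7_ge16 p7.
rewrite leNgt; apply/negP => HK.
apply: (@long_residue_interval_false R p l s u H) => //.
  move=> v /andP[v0 vH] uv; apply: ker; apply: chi1; first by rewrite !lez_nat v0.
  by rewrite -[coprimez _ _]/(coprime v u) coprime_sym prime_coprime.
(* Since [g p >= 1] and [K >= 28/5], a failure of the claimed bound puts [H] above
   [28/5 p^(1/4) ln p]. *)
apply: le_lt_trans HK; rewrite /powR gt_eqF; last by rewrite ltr0n prime_gt0.
rewrite [1 / 4 * _]mulrC div1r; apply: ler_wpM2r; first by lra.
apply: ler_wpM2r; first exact: expR_ge0.
apply: le_trans (K_ge R) _; rewrite ler_peMr ?g_ge1 //.
by apply: le_trans (K_ge R); lra.
Qed.
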